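(* Fix $t\in[0,T]$ and let $g\in W^{1,2}(\mathbb T^d;\mathbb R^d)$. Then $$\mathcal L_{\mathrm{ISM},t}(g)=\mathcal L_{\mathrm{ISM},t}(\tilde s_t)+\mathbb E_{\tilde f_t}\|g-\tilde s_t\|^2 .$$ Hence $$\delta_2(t)^2=\mathcal L_{\mathrm{ISM},t}(s_\theta)-\mathcal L_{\mathrm{ISM},t}(\tilde s_t),\qquad\text{where }\ \delta_2(t)^2:=\mathbb E_{v\sim\tilde f_t}\big[\|s_\theta(v,t)-\tilde s_t(v)\|^2\big].$$
   Context: $\mathbb T^d=\mathbb R^d/\mathbb Z^d$, $d\in\{2,3\}$, $T>0$. For each $t\in[0,T]$, $\tilde f_t\in W^{2,\infty}(\mathbb T^d)$ is a (positive) probability density (the solution of the spatially homogeneous Landau equation at time $t$), with score $\tilde s_t:=\nabla_v\log\tilde f_t$, satisfying $\|\nabla_v\tilde s_t\|_{L^\infty(\mathbb T^d)}<\infty$. The approximate score $s_\theta(\cdot,t):\mathbb T^d\to\mathbb R^d$ is Lipschitz. The Hyvärinen (implicit score matching) functional is $$\mathcal L_{\mathrm{ISM},t}(g):=\mathbb E_{v\sim\tilde f_t}\big[\|g(v)\|^2+2\nabla_v\cdot g(v)\big],$$ and $\mathcal L_{\mathrm{ISM},t}(s_\theta)$ means $g=s_\theta(\cdot,t)$. *)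

(* Defs.v *)
From HB Require Import structures.
From mathcomp Require Import all_boot all_order all_algebra.
From mathcomp Require Import all_classical all_reals all_analysis.

Set Implicit Arguments.
Unset Strict Implicit.
Unset Printing Implicit Defensive.
Import Order.TTheory GRing.Theory Num.Theory.
Import numFieldNormedType.Exports.

Local Open Scope classical_set_scope.
Local Open Scope ring_scope.

Definition measure_rV_display : measure_display.
Proof. exact: default_measure_display. Qed.

(* The Borel sigma-algebra of R^n, generated by the coordinate maps as the
   library does for n.-tuple T. *)
Definition coor {R : realType} {n : nat} (i : 'I_n) (x : 'rV[R]_n) : R :=
  x ord0 i.

Section measurable_rV.
Context {R : realType} {n : nat}.

Let rV_set0 : g_sigma_preimage (@coor R n) set0.
Proof. exact: sigma_algebra0. Qed.

Let rV_setC A :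
  g_sigma_preimage (@coor R n) A -> g_sigma_preimage (@coor R n) (~` A).
Proof. exact: sigma_algebraC. Qed.

Let rV_bigcup (F : _^nat) : (forall i, g_sigma_preimage (@coor R n) (F i)) ->
  g_sigma_preimage (@coor R n) (\bigcup_i (F i)).
Proof. exact: sigma_algebra_bigcup. Qed.

HB.instance Definition _ := @isMeasurable.Build measure_rV_display
  'rV[R]_n (g_sigma_preimage (@coor R n)) rV_set0 rV_setC rV_bigcup.

End measurable_rV.

Lemma measurable_fun_rVP (R : realType) n d (T : measurableType d)
    (f : T -> 'rV[R]_n) :
  measurable_fun [set: T] f <->
  forall i, measurable_fun [set: T] (coor i \o f).
Proof.
apply: (@iff_trans _ (g_sigma_preimage (fun i => coor i \o f) `<=` measurable)).
  rewrite g_sigma_preimage_comp; split=> [mf A [/= C preC <-]|prefS].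
    exact: mf.
  by move=> _ A mA; apply: prefS; exists A.
split=> [fS i|mf].
- move=> _ A mA.
  apply: fS; apply: sub_sigma_algebra.
  case: n i => [[] []//|n i] in f *.
  rewrite -bigcup_mkord_ord.
  exists i; first exact: ltn_ord.
  by exists A => //; rewrite inord_val.
- apply: smallest_sub; first exact: sigma_algebra_measurable.
  case: n => [|n] in f mf *; first by rewrite big_ord0.
  rewrite -bigcup_mkord_ord; apply: bigcup_sub => i Ii.
  by move=> A [B mB <-]; exact: mf.
Qed.

Section torus_measure.
Context {R : realType}.

Definition rV_cons n (p : measurableTypeR R * 'rV[R]_n) : 'rV[R]_n.+1 :=
  row_mx (const_mx p.1 : 'rV[R]_1) p.2.

Lemma measurable_rV_cons n : measurable_fun setT (@rV_cons n).
Proof.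
apply/measurable_fun_rVP => i.
case: (unliftP ord0 i) => [j|] ->; last first.
  rewrite (_ : _ \o _ = fst); first exact: measurable_fst.
  apply/funext => -[x y] /=; rewrite /coor /rV_cons.
  have -> : (ord0 : 'I_n.+1) = lshift n (ord0 : 'I_1) by exact: val_inj.
  by apply: etrans (row_mxEl _ _ _ _) _; rewrite mxE.
rewrite (_ : _ \o _ = coor j \o snd); last first.
  apply/funext => -[x y] /=; rewrite /coor /rV_cons.
  have -> : lift ord0 j = rshift 1 j by exact: val_inj.
  exact: row_mxEr.
by move: j; apply/measurable_fun_rVP; exact: measurable_snd.
Qed.

HB.instance Definition _ n :=
  isMeasurableFun.Build _ _ _ _ (@rV_cons n) (@measurable_rV_cons n).

(* A function on T^d = R^d / Z^d is a Z^d-periodic function on R^d; it is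
   integrated over the fundamental cell [0, 1]^d, against the d-fold product of
   the Lebesgue measure of [0, 1]. *)
Fixpoint torus_measure (d : nat) : probability 'rV[R]_d R :=
  match d with
  | 0 => dirac (0 : 'rV[R]_0)
  | n.+1 => distribution
      (uniform_prob (@ltr01 R) \x torus_measure n)%E (@rV_cons n)
  end.

End torus_measure.

Section torus_functions.
Context {R : realType} {d : nat}.
Implicit Types (u w f : 'rV[R]_d -> R) (g s : 'rV[R]_d -> 'rV[R]_d).

Local Notation mu := (@torus_measure R d).

Definition Zd_periodic {V : Type} (h : 'rV[R]_d -> V) : Prop :=
  forall (k : 'rV[int]_d) (x : 'rV[R]_d), h (x + map_mx intr k) = h x.

Definition basis_vec (i : 'I_d) : 'rV[R]_d := delta_mx ord0 i.

Fixpoint Ck (k : nat) (u : 'rV[R]_d -> R) : Prop :=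
  continuous u /\
  match k with
  | 0 => True
  | k'.+1 => forall i, (forall x, derivable u x (basis_vec i)) /\
                       Ck k' (fun x => 'D_(basis_vec i) u x)
  end.

Definition test_function (phi : 'rV[R]_d -> R) : Prop :=
  Zd_periodic phi /\ forall k, Ck k phi.

Definition Lp (p : \bar R) (u : 'rV[R]_d -> R) : Prop :=
  Zd_periodic u /\ u \in Lfun mu p.

Definition is_wpartial (i : 'I_d) u w : Prop :=
  [/\ Lp 1%E u, Lp 1%E w &
      forall phi, test_function phi ->
        \int[mu]_x (u x * 'D_(basis_vec i) phi x) =
        - \int[mu]_x (w x * phi x)].

(* A version of the weak partial derivative, which is unique up to a null set
   when it exists; the value 0 is used when there is none. *)
Definition wpartial (i : 'I_d) u : 'rV[R]_d -> R :=
  xget (cst 0) [set w | is_wpartial i u w].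

(* W^{k,p}: by uniqueness of weak derivatives, iterating them one at a time gives
   the usual condition on all multi-indices of length at most k. *)
Fixpoint Sobolev (k : nat) (p : \bar R) (u : 'rV[R]_d -> R) : Prop :=
  Lp p u /\
  match k with
  | 0 => True
  | k'.+1 => forall i, exists2 w, is_wpartial i u w & Sobolev k' p w
  end.

Definition vSobolev (k : nat) (p : \bar R) g : Prop :=
  forall j, Sobolev k p (coor j \o g).

Definition is_wgradient u s : Prop :=
  forall i, is_wpartial i u (coor i \o s).

Definition wdiv g (x : 'rV[R]_d) : R :=
  \sum_(i < d) wpartial i (coor i \o g) x.

(* `|x| is the sup norm on 'rV[R]_d, hence this separate Euclidean norm. *)
Definition sqnorm (x : 'rV[R]_d) : R := \sum_(i < d) coor i x ^+ 2.

(* Positivity is a condition on the a.e. class of f; it follows from positivity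
   of the continuous representative. *)
Definition positive_density f : Prop :=
  [/\ Zd_periodic f, measurable_fun setT f, {ae mu, forall x, 0 < f x} &
      (\int[mu]_x (f x)%:E = 1)%E].

Definition expect f (h : 'rV[R]_d -> R) : R := \int[mu]_x (h x * f x).

Definition score_of f s : Prop := is_wgradient (fun x => ln (f x)) s.

(* ||nabla s||_oo < oo: boundedness of all entries does not depend on the choice
   of a matrix norm. *)
Definition bounded_wjacobian s : Prop :=
  forall i j, exists2 w, is_wpartial i (coor j \o s) w & Lp +oo%E w.

Definition ISM f g : R := expect f (fun v => sqnorm (g v) + 2 * wdiv g v).

(* A periodic map is Lipschitz for the quotient distance of R^d / Z^d iff it is
   Lipschitz on R^d. *)
Definition torus_lipschitz g : Prop := Zd_periodic g /\ lipschitz g.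

(* delta_2(t), for f = f_t, s = s_t and g = s_theta(., t) *)
Definition delta2 f s g : R :=
  Num.sqrt (expect f (fun v => sqnorm (g v - s v))).

End torus_functions.

(* Main.v *)
Require Import Defs.
From HB Require Import structures.
From mathcomp Require Import all_boot all_order all_algebra.
From mathcomp Require Import all_classical all_reals all_analysis.
From mathcomp Require Import measurable_realfun ess_sup_inf ring lra.
Import Order.TTheory GRing.Theory Num.Theory.
Import numFieldNormedType.Exports.
Set Implicit Arguments.
Unset Strict Implicit.
Unset Printing Implicit Defensive.
Local Open Scope classical_set_scope.
Local Open Scope ring_scope.

(* Expanding the square, the identity reduces to the two integrations by parts
     \int (div g) f = - \int g . (f s)   and   \int (div s) f = - \int |s|^2 f,
   together with the existence of weak derivatives of Lipschitz maps.

   Test functions are dense in L^1, since exp (- exp (- n q)) with q a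
   trigonometric polynomial tends to the indicator of {q > 0}. If w is a weak
   partial derivative of u, the mean value theorem applied to the smooth function
   t |-> \int u (x + t e_i) phi (x) dx and L^1-duality show that the difference
   quotients of u converge to w in L^1. Passing to an almost everywhere
   convergent subsequence in f (x + t e_i) = exp (ln f (x + t e_i)) gives
   grad f = f s; in particular f s is bounded, hence no integrability of s beyond
   L^1 is needed. The product rule also follows from the difference quotients.

   For a Lipschitz map, the difference quotients are bounded; near-minimizers of
   the L^2 norm among the functions weakly close to their tails converge almost
   everywhere along a subsequence, and the limit is the weak derivative. *)

(** * Borel sets and translation invariance on the torus *)

(** The obstacle is low regularity on both sides: [s] is known only as an L^1 weak gradient of
    [ln f], while [f] is positive and bounded only almost everywhere. Classical calculus is
    therefore confined to test functions. All other functions are handled through translations along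
    the axes: these preserve the torus measure, so a difference quotient can be moved from one
    factor of an integral to the other.

    Both integrations by parts are instances of one statement, applied to [g] and to [s]. Write GG,
    GS and SS for the integrals of [|g|^2 f], [g . (f s)] and [s . (f s)]. Then
    [ISM f g = GG - 2 GS] and [ISM f s = SS - 2 SS = - SS], and these differ by [GG - 2 GS + SS],
    the integral of [|g - s|^2 f].

    The decomposition asks of [g] square-integrable coordinates and, for each [j], a weak derivative
    of the [j]-th coordinate in direction [j]. Maps in W^{1,2} have both by definition and Lipschitz
    maps by construction, so the two halves of the theorem share one proof. *)

Section borel_rV.
Context {R : realType} {d : nat}.

Lemma measurable_coor (i : 'I_d) : measurable_fun setT (@coor R d i).
Proof. by have /measurable_fun_rVP := @measurable_id _ 'rV[R]_d setT; exact. Qed.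

Lemma rV_ball_measurable (q : 'rV[R]_d) (e : R) :
  measurable (ball q e : set 'rV[R]_d).
Proof.
have [e0|e0] := ltP 0 e; last first.
  rewrite (_ : ball q e = set0)//; apply/seteqP; split => // x [].
  by rewrite ltNge e0.
rewrite (_ : ball q e = \bigcap_(i in [set: 'I_d]) (coor i @^-1` ball (coor i q) e)).
  apply: fin_bigcap_measurable; first exact: finite_finset.
  move=> i _; rewrite -[X in measurable X]setTI; apply: measurable_coor => //.
  by rewrite ball_itv; exact: measurable_itv.
apply/seteqP; split => x /=.
- by move=> [_ xe] i _ /=; exact: xe.
- by move=> xe; split => // i j; rewrite ord1; exact: xe.
Qed.

(** Balls of the sup norm are boxes, hence measurable for the sigma-algebra generated by the
    coordinates; an open set is the countable union of those balls with rational centre and radius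
    [1 / (n + 1)] that it contains. *)
Lemma open_rV_measurable (U : set 'rV[R]_d) : open U -> measurable U.
Proof.
move=> oU.
pose B (p : 'rV[rat]_d * nat) : set 'rV[R]_d :=
  ball (map_mx ratr p.1 : 'rV[R]_d) p.2.+1%:R^-1.
pose F p := if `[< B p `<=` U >] then B p else set0.
rewrite (_ : U = \bigcup_p F p).
  apply: countable_bigcupT_measurable => // p.
  by rewrite /F; case: ifPn => // _; exact: rV_ball_measurable.
apply/seteqP; split => [x Ux|x [p _]]; last first.
  by rewrite /F; case: ifPn => // /asboolP; exact.
have /nbhs_ballP[e /= e0 xeU] : nbhs x U by exact: open_nbhs_nbhs.
have [n ne] : exists n : nat, n.+1%:R^-1 < e / 2 :> R.
  have := near_infty_natSinv_lt (PosNum (divr_gt0 e0 (ltr0n R 2))).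
  by case=> N _ /(_ N (leqnn _)) ?; exists N.
have n0 : 0 < n.+1%:R^-1 :> R by rewrite invr_gt0.
have /choice[q qx] : forall i : 'I_d, exists q : rat,
    ball (ratr q : R) n.+1%:R^-1 (x ord0 i : R).
  move=> i.
  have [||y [xy [q _ qy]]] := @dense_rat R (ball (x ord0 i : R) n.+1%:R^-1).
  - by exists (x ord0 i); exact: ballxx.
  - exact: ball_open.
  - by exists q; rewrite qy; exact: ball_sym.
have Bx : B (\row_i q i, n) x.
  by split => // i j; rewrite ord1 !mxE; exact: qx.
exists (\row_i q i, n) => //; rewrite /F; case: ifPn => // /asboolP; case.
move=> y By; apply: xeU; apply: (@le_ball _ _ _ (n.+1%:R^-1 + n.+1%:R^-1)).
  by rewrite (splitr e) lerD// ltW.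
by apply: ball_triangle By; exact: ball_sym.
Qed.

Lemma continuous_rV_measurable (u : 'rV[R]_d -> R) :
  continuous u -> measurable_fun setT u.
Proof.
move=> /continuousP cu; apply: (measurability _ (RGenOpens.measurableE R)).
move=> _ [_ [a [b ->] <-]]; rewrite setTI; apply: open_rV_measurable.
exact/cu/interval_open.
Qed.

Lemma measurable_translate (a : 'rV[R]_d) :
  measurable_fun setT (fun x : 'rV[R]_d => x + a).
Proof.
apply/measurable_fun_rVP => i.
rewrite (_ : _ \o _ = (fun x => coor i x + coor i a)); last first.
  by apply/funext => x /=; rewrite /coor mxE.
by apply: measurable_funD => //; exact: measurable_coor.
Qed.

End borel_rV.

Section torus_invariance.
Context {R : realType}.
Local Notation mu := (@torus_measure R _).
Local Notation U01 := (uniform_prob (@ltr01 R)).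

Lemma lebesgue_measure_translate (r : R) (A : set (measurableTypeR R)) :
  measurable A ->
  lebesgue_measure A = lebesgue_measure ((fun x => x + r) @^-1` A).
Proof.
move=> mA.
have mr : measurable_fun setT (fun x : measurableTypeR R => x + r : measurableTypeR R).
  exact: measurable_funD.
apply: (@lebesgue_measure_unique R (pushforward lebesgue_measure
  (fun x : measurableTypeR R => x + r : measurableTypeR R))) => // X [[a b]/= _ <-].
rewrite /pushforward.
rewrite (_ : _ @^-1` _ = `]a - r, b - r]%classic); last first.
  by apply/seteqP; split => x /=; rewrite !in_itv/= lerBrDr ltrBlDr.
rewrite !lebesgue_measure_itv/= !lte_fin ltrD2r; case: ifPn => // _.
by rewrite -!EFinD; congr EFin; ring.
Qed.


Lemma ge0_integral_itvco_translate (a b r : R) (h : R -> \bar R) :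
  measurable_fun setT h -> (forall x, 0 <= h x)%E ->
  (\int[lebesgue_measure]_(x in `[a, b[) h (x + r)%R =
   \int[lebesgue_measure]_(x in `[(a + r)%R, (b + r)%R[) h x)%E.
Proof.
move=> mh h0.
have mr : measurable_fun setT (fun x : measurableTypeR R => x + r : measurableTypeR R).
  exact: measurable_funD.
pose m2 := pushforward lebesgue_measure
  (fun x : measurableTypeR R => x + r : measurableTypeR R).
transitivity (\int[m2]_(x in `[(a + r)%R, (b + r)%R[) h x)%E.
  rewrite ge0_integral_pushforward//; last exact: measurable_funTS.
  by congr (integral _ _ _); apply/seteqP; split => x /=; rewrite !in_itv/= lerD2r ltrD2r.
by apply: eq_measure_integral => A mA _; rewrite [RHS](lebesgue_measure_translate r).
Qed.

Lemma ge0_integral_itvco_split (a b c : R) (h : R -> \bar R) : a <= b -> b <= c ->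
  measurable_fun setT h -> (forall x, 0 <= h x)%E ->
  (\int[lebesgue_measure]_(x in `[a, c[) h x =
   \int[lebesgue_measure]_(x in `[a, b[) h x +
   \int[lebesgue_measure]_(x in `[b, c[) h x)%E.
Proof.
move=> ab bc mh h0; rewrite -ge0_integral_setU//=.
- by congr (integral _ _ _); rewrite -itv_bndbnd_setU.
- exact: measurable_funTS.
- apply/disj_setPS => x [/=]; rewrite !in_itv/= => /andP[_ xb] /andP[].
  by rewrite leNgt xb.
Qed.

(** Once [r] is reduced to its fractional part, [[r, 1 + r[] is cut at 1 and the second piece is
    moved back by one period onto [[0, r[]. *)
Lemma ge0_integral_uniform_translate (r : R) (h : R -> \bar R) :
  measurable_fun setT h -> (forall x, 0 <= h x)%E ->
  (forall (k : int) x, h (x + k%:~R) = h x) ->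
  (\int[U01]_x h (x + r)%R = \int[U01]_x h x)%E.
Proof.
move=> mh h0 hk.
wlog /andP[r0 r1] : r / 0 <= r < 1 => [hw|].
  rewrite -(hw (r - (Num.floor r)%:~R)).
    apply: eq_integral => x _.
    by rewrite -(hk (Num.floor r) (x + (r - _))); congr h; ring.
  by rewrite subr_ge0 floor_le_tmp ltrBlDl -(intrD _ _ 1) floorD1_gt.
have mhr : measurable_fun setT (fun x : R => h (x + r)).
  by apply: measurableT_comp => //; exact: measurable_funD.
rewrite !integral_uniform//; congr (_ * _)%E.
(* Half-open intervals can be cut and glued without overlap; dropping the endpoint 1 costs a null
   set. *)
have co (g : R -> \bar R) : measurable_fun setT g ->
    (\int[lebesgue_measure]_(x in `[0%R, 1%R]) g x =
     \int[lebesgue_measure]_(x in `[0%R, 1%R[) g x)%E.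
  by move=> mg; rewrite integral_itv_bndo_bndc//; exact: measurable_funTS.
rewrite (co _ mhr) (co _ mh).
rewrite ge0_integral_itvco_translate// add0r.
rewrite (@ge0_integral_itvco_split r 1 (1 + r))//; [|exact: ltW|by rewrite lerDl].
rewrite (@ge0_integral_itvco_split 0 r 1)//; last exact: ltW.
rewrite addeC; congr (_ + _)%E.
rewrite -{1}[1]add0r (addrC 1) -ge0_integral_itvco_translate//.
by apply: eq_integral => x _; rewrite (hk 1).
Qed.

Lemma torus_tonelli n (F : 'rV[R]_n.+1 -> \bar R) :
  measurable_fun setT F -> (forall x, 0 <= F x)%E ->
  (\int[mu]_x F x = \int[U01]_y \int[mu]_z F (rV_cons (y, z)))%E.
Proof.
move=> mF F0; rewrite ge0_integral_distribution//= fubini_tonelli1//.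
by apply: measurableT_comp => //; exact: measurable_rV_cons.
Qed.

Lemma rV_cons_ord0 n (p : R * 'rV[R]_n) : rV_cons p ord0 ord0 = p.1.
Proof.
have -> : (ord0 : 'I_n.+1) = lshift n (ord0 : 'I_1) by exact: val_inj.
by apply: etrans (row_mxEl _ _ _ _) _; rewrite mxE.
Qed.

Lemma rV_cons_lift n (p : R * 'rV[R]_n) (j : 'I_n) :
  rV_cons p ord0 (lift ord0 j) = p.2 ord0 j.
Proof.
have -> : lift ord0 j = rshift 1 j by exact: val_inj.
exact: row_mxEr.
Qed.

Lemma rV_consD n (p q : R * 'rV[R]_n) :
  rV_cons p + rV_cons q = rV_cons (p.1 + q.1, p.2 + q.2).
Proof.
apply/rowP => i; rewrite [LHS]mxE; have [j|] := unliftP ord0 i => ->.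
  by rewrite !rV_cons_lift mxE.
by rewrite !rV_cons_ord0.
Qed.

Lemma basis_vec_ord0 n (r : R) :
  r *: basis_vec ord0 = rV_cons (r, 0 : 'rV[R]_n).
Proof.
apply/rowP => i; rewrite [LHS]mxE; have [j|] := unliftP ord0 i => ->.
  by rewrite rV_cons_lift !mxE /= mulr0.
by rewrite rV_cons_ord0 mxE /= mulr1.
Qed.

Lemma basis_vec_lift n (i : 'I_n) (r : R) :
  r *: basis_vec (lift ord0 i) = rV_cons (0, r *: basis_vec i).
Proof.
apply/rowP => k; rewrite [LHS]mxE; have [j|] := unliftP ord0 k => ->.
  by rewrite rV_cons_lift !mxE /= (inj_eq (@lift_inj _ ord0)).
by rewrite rV_cons_ord0 mxE /= mulr0.
Qed.

Lemma periodic_rV_cons1 n V (F : 'rV[R]_n.+1 -> V) (k : int) y z :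
  Zd_periodic F -> F (rV_cons (y + k%:~R, z)) = F (rV_cons (y, z)).
Proof.
move=> pF; rewrite -[RHS](pF (\row_i (if i == ord0 then k else 0))).
rewrite -[z in LHS]addr0 -(rV_consD (y, z) (k%:~R, 0)); congr (F (_ + _)).
apply/rowP => i; rewrite [RHS]mxE mxE; have [j|] := unliftP ord0 i => ->.
  by rewrite rV_cons_lift mxE.
by rewrite rV_cons_ord0.
Qed.

Lemma periodic_rV_cons n V (F : 'rV[R]_n.+1 -> V) y :
  Zd_periodic F -> Zd_periodic (fun z => F (rV_cons (y, z))).
Proof.
move=> pF k z.
rewrite -[RHS](pF (\row_i (if unlift ord0 i is Some j then k ord0 j else 0))).
rewrite -[y in LHS]addr0 -(rV_consD (y, z) (0, map_mx intr k)); congr (F (_ + _)).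
apply/rowP => i; rewrite [RHS]mxE mxE; have [j|] := unliftP ord0 i => ->.
  by rewrite rV_cons_lift mxE.
by rewrite rV_cons_ord0.
Qed.

(** Induction on the dimension through Tonelli: a shift of the first coordinate is the
    one-dimensional case applied to the partial integral over the others, and a shift of another
    coordinate is the induction hypothesis on each slice. *)
Lemma ge0_integral_torus_translate n (i : 'I_n) (r : R) (F : 'rV[R]_n -> \bar R) :
  measurable_fun setT F -> (forall x, 0 <= F x)%E -> Zd_periodic F ->
  (\int[mu]_x F (x + r *: basis_vec i)%R = \int[mu]_x F x)%E.
Proof.
elim: n i F => [[]//|n IH] i F mF F0 pF.
have mtr : measurable_fun setT (fun x : 'rV[R]_n.+1 => F (x + r *: basis_vec i)).
  by apply: measurableT_comp => //; exact: measurable_translate.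
have mFc : measurable_fun setT (fun x => F (rV_cons x)).
  by apply: measurableT_comp => //; exact: measurable_rV_cons.
rewrite !torus_tonelli//.
have [j|] := unliftP ord0 i => ->; last first.
  transitivity (\int[U01]_y (fun y => \int[mu]_z F (rV_cons (y, z))) (y + r)%R)%E.
    apply: eq_integral => y _; apply: eq_integral => z _.
    by rewrite basis_vec_ord0 rV_consD /= addr0.
  rewrite (@ge0_integral_uniform_translate r (fun y => \int[mu]_z F (rV_cons (y, z)))%E)//.
  - exact: (@measurable_fun_fubini_tonelli_F _ _ _ _ _ mu (fun x => F (rV_cons x))).
  - by move=> y; apply: integral_ge0 => z _.
  - by move=> k y; apply: eq_integral => z _; rewrite periodic_rV_cons1.
apply: eq_integral => y _.
rewrite -[RHS](IH j)//.
- by apply: eq_integral => z _; rewrite basis_vec_lift rV_consD /= addr0.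
- exact: (measurableT_comp mFc (pair1_measurable y)).
- exact: periodic_rV_cons.
Qed.

Lemma integral_torus_translate n (i : 'I_n) (r : R) (F : 'rV[R]_n -> \bar R) :
  measurable_fun setT F -> Zd_periodic F ->
  (\int[mu]_x F (x + r *: basis_vec i)%R = \int[mu]_x F x)%E.
Proof.
move=> mF pF; rewrite [LHS]integralE [RHS]integralE; congr (_ - _)%E.
- rewrite -(@ge0_integral_torus_translate _ i r (F^\+)%E).
  + by apply: eq_integral => x _; rewrite !funeposE.
  + exact: measurable_funepos.
  + by move=> x; exact: funepos_ge0.
  + by move=> k x; rewrite !funeposE pF.
- rewrite -(@ge0_integral_torus_translate _ i r (F^\-)%E).
  + by apply: eq_integral => x _; rewrite !funenegE.
  + exact: measurable_funeneg.
  + by move=> x; exact: funeneg_ge0.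
  + by move=> k x; rewrite !funenegE pF.
Qed.

(** This reduces null sets that depend on a single coordinate to null sets of the line. *)
Lemma torus_measure_coor n (i : 'I_n) (A : set (measurableTypeR R)) :
  measurable A -> mu (coor i @^-1` A) = U01 A.
Proof.
elim: n i => [[]//|n IH] i mA.
have [j|] := unliftP ord0 i => ->; rewrite /= /distribution /pushforward.
- rewrite (_ : _ @^-1` _ = setT `*` (coor j @^-1` A)); last first.
    apply/seteqP; split => -[y z] /=; rewrite /coor rV_cons_lift; first by split.
    by case.
  rewrite product_measure1E//; last first.
    by rewrite -[X in measurable X]setTI; exact: measurable_coor.
  rewrite -(IH j mA).
  by apply: etrans (congr1 (fun a => (a * _)%E) (probability_setT U01)) (mul1e _).
- rewrite (_ : _ @^-1` _ = A `*` setT); last first.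
    apply/seteqP; split => -[y z] /=; rewrite /coor rV_cons_ord0; first by split.
    by case.
  rewrite product_measure1E//.
  by apply: etrans (congr1 (fun a => (_ * a)%E) (probability_setT mu)) (mule1 _).
Qed.

End torus_invariance.

(** * Test functions *)

Section Ck_algebra.
Context {R : realType} {d : nat}.
Implicit Types u w : 'rV[R]_d -> R.

(** Restricting to a line makes the one-variable chain rule and mean value theorem available for
    directional derivatives. *)
Lemma is_derive_line u (x v : 'rV[R]_d) (t a : R) :
  is_derive t 1 (fun h : R => u (x + h *: v)) a <-> is_derive (x + t *: v) v u a.
Proof.
suff E : (fun h : R => h^-1 *: (((fun h => u (x + h *: v)) \o shift t) (h *: (1 : R))
    - u (x + t *: v))) =
  (fun h => h^-1 *: ((u \o shift (x + t *: v)) (h *: v) - u (x + t *: v))).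
  by split => -[H1 H2]; split; move: H1 H2; rewrite /derivable /derive /= ?E// -?E.
apply/funext => h /=; congr (_ *: (u _ - _)).
by rewrite scalerDl [h%:A]mulr1 addrCA.
Qed.

Lemma is_derive_comp_expR u (x v : 'rV[R]_d) a :
  is_derive x v u a -> is_derive x v (fun y => expR (u y)) (expR (u x) * a).
Proof.
move=> H.
have /is_derive_line Hl : is_derive (x + (0 : R) *: v) v u a.
  by rewrite scale0r addr0.
have := is_derive1_comp (is_derive_expR _) Hl.
rewrite scale0r addr0 => /(is_derive_line (fun y => expR (u y)) x v 0 _).1.
by rewrite scale0r addr0.
Qed.

(** The derivative is written as a cosine with phase advanced by [pi / 2], so that the family
    [cos (a x_j + b)] is stable under differentiation and smoothness follows by induction with [b]
    varying. *)
Lemma is_derive_cos_coor (i j : 'I_d) (a b : R) (x : 'rV[R]_d) :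
  is_derive x (basis_vec i) (fun y : 'rV[R]_d => cos (a * coor j y + b))
    ((i == j)%:R * a * cos (a * coor j x + b + pi / 2)).
Proof.
pose k := a * (i == j)%:R.
have H1 : is_derive (0 : R) 1 (k \*: id + cst (a * coor j x + b)) (k *: 1 + 0).
  by apply: is_deriveD.
have := is_derive1_comp (is_derive_cos _) H1.
rewrite (_ : cos \o _ = (fun h : R => cos (a * coor j (x + h *: basis_vec i) + b))).
  move=> /(is_derive_line (fun y => cos (a * coor j y + b)) x (basis_vec i) 0 _).1.
  rewrite scale0r addr0 => H.
  have E0 : (k \*: id + cst (a * coor j x + b)) (0 : R) = a * coor j x + b.
    by rewrite fctE /= scaler0 add0r.
  apply: is_derive_eq H _; rewrite E0 cosDpihalf addr0 [k%:A]mulr1 /k.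
  by rewrite mulrC (mulrC a).
apply/funext => h /=; congr cos.
have -> : (k \*: id + cst (a * coor j x + b)) h = k * h + (a * coor j x + b) by [].
by rewrite /coor !mxE eqxx /= /k [i == j]eq_sym; ring.
Qed.

Lemma continuous_rVD u w : continuous u -> continuous w ->
  continuous (fun x => u x + w x).
Proof. by move=> cu cw x; exact: (cvgD (cu x) (cw x)). Qed.

Lemma continuous_rVM u w : continuous u -> continuous w ->
  continuous (fun x => u x * w x).
Proof. by move=> cu cw x; exact: (cvgM (cu x) (cw x)). Qed.

Lemma continuous_rV_translate u (y : 'rV[R]_d) : continuous u ->
  continuous (fun x : 'rV[R]_d => u (x + y)).
Proof.
move=> cu x; apply: (@continuous_comp _ _ _ (fun x : 'rV[R]_d => x + y)); last exact: cu.
apply: (@cvgD _ _ _ (nbhs x) _ idfun (fun=> y) x y); [exact: cvg_id|exact: cst_continuous].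
Qed.

Lemma CkW k u : Ck k.+1 u -> Ck k u.
Proof.
elim: k u => [|k IH] u [cu H]; first by split.
by split => // i; have [du Hi] := H i; split => //; exact: IH.
Qed.

Lemma Ck_cst k (c : R) : Ck k (cst c : 'rV[R]_d -> R).
Proof.
elim: k c => [|k IH] c; first by split => //; exact: cst_continuous.
split=> [|i]; first exact: cst_continuous.
split; first by move=> x; exact: derivable_cst.
by rewrite (_ : (fun x => _) = cst 0)//; apply/funext => x; rewrite derive_cst.
Qed.

Lemma CkD k u w : Ck k u -> Ck k w -> Ck k (fun x => u x + w x).
Proof.
elim: k u w => [|k IH] u w [cu Hu] [cw Hw].
  by split => //; exact: continuous_rVD.
split; first exact: continuous_rVD.
move=> i; have [du Hui] := Hu i; have [dw Hwi] := Hw i; split.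
  by move=> x; exact: derivableD.
rewrite (_ : (fun x => 'D_(basis_vec i) _ x) =
  (fun x => 'D_(basis_vec i) u x + 'D_(basis_vec i) w x)); first exact: IH.
by apply/funext => x; exact: deriveD.
Qed.

Lemma CkM k u w : Ck k u -> Ck k w -> Ck k (fun x => u x * w x).
Proof.
elim: k u w => [|k IH] u w Cu Cw; have [cu Hu] := Cu; have [cw Hw] := Cw.
  by split => //; exact: continuous_rVM.
split; first exact: continuous_rVM.
move=> i; have [du Hui] := Hu i; have [dw Hwi] := Hw i; split.
  by move=> x; exact: derivableM.
rewrite (_ : (fun x => 'D_(basis_vec i) _ x) =
  (fun x => u x * 'D_(basis_vec i) w x + w x * 'D_(basis_vec i) u x)).
  by apply: CkD; apply: IH => //; exact: CkW.
by apply/funext => x; exact: deriveM.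
Qed.

Lemma Ck_expR k u : Ck k u -> Ck k (fun x => expR (u x)).
Proof.
elim: k u => [|k IH] u Cu; have [cu Hu] := Cu.
  by split => // x; apply: continuous_comp; [exact: cu|exact: continuous_expR].
split; first by move=> x; apply: continuous_comp; [exact: cu|exact: continuous_expR].
move=> i; have [du Hui] := Hu i.
have dE x : is_derive x (basis_vec i) (fun y => expR (u y))
    (expR (u x) * 'D_(basis_vec i) u x).
  by apply: is_derive_comp_expR; exact: derivableP.
split; first by move=> x; have [] := dE x.
rewrite (_ : (fun x => 'D_(basis_vec i) _ x) =
  (fun x => expR (u x) * 'D_(basis_vec i) u x)).
  by apply: CkM => //; apply: IH; exact: CkW.
by apply/funext => x; have [_] := dE x.
Qed.

Lemma Ck_cos_coor k (j : 'I_d) (a b : R) :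
  Ck k (fun y : 'rV[R]_d => cos (a * coor j y + b)).
Proof.
have cc c : continuous (fun y : 'rV[R]_d => cos (a * coor j y + c)).
  move=> y; apply: continuous_comp; last exact: continuous_cos.
  apply: (@continuous_rVD (fun y => a * coor j y) (cst c)); last exact: cst_continuous.
  apply: (@continuous_rVM (cst a) (coor j)); first exact: cst_continuous.
  exact: coord_continuous.
elim: k b => [|k IH] b; split => // i.
have dE x := is_derive_cos_coor i j a b x.
split; first by move=> x; have [] := dE x.
rewrite (_ : (fun x => 'D_(basis_vec i) _ x) =
  (fun x => ((i == j)%:R * a) * cos (a * coor j x + (b + pi / 2)))).
  by apply: CkM => //; exact: Ck_cst.
by apply/funext => x; rewrite addrA; have [_] := dE x.
Qed.

Lemma is_derive_translate u (y x v : 'rV[R]_d) a :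
  is_derive (x + y) v u a <-> is_derive x v (fun z => u (z + y)) a.
Proof.
suff E : (fun h : R => h^-1 *: (((fun z => u (z + y)) \o shift x) (h *: v)
    - u (x + y))) =
  (fun h => h^-1 *: ((u \o shift (x + y)) (h *: v) - u (x + y))).
  by split => -[H1 H2]; split; move: H1 H2; rewrite /derivable /derive /= ?E// -?E.
by apply/funext => h /=; rewrite addrA.
Qed.

Lemma derive_translate u (y x v : 'rV[R]_d) :
  'D_v (fun z => u (z + y)) x = 'D_v u (x + y).
Proof.
rewrite /derive (_ : (fun h : R => _) =
  (fun h => h^-1 *: ((u \o shift (x + y)) (h *: v) - u (x + y))))//.
by apply/funext => h /=; rewrite addrA.
Qed.

Lemma derivable_translate u (y x v : 'rV[R]_d) :
  derivable u (x + y) v -> derivable (fun z => u (z + y)) x v.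
Proof. by move=> /derivableP/is_derive_translate []. Qed.

Lemma Ck_translate k u (y : 'rV[R]_d) : Ck k u -> Ck k (fun x => u (x + y)).
Proof.
elim: k u => [|k IH] u [cu Hu].
  by split => //; exact: continuous_rV_translate.
split; first exact: continuous_rV_translate.
move=> i; have [du Hui] := Hu i; split.
  by move=> x; exact: derivable_translate.
rewrite (_ : (fun x => 'D_(basis_vec i) _ x) =
  (fun x => 'D_(basis_vec i) u (x + y))); first exact: (IH (fun x => 'D_(basis_vec i) u x)).
by apply/funext => x; rewrite derive_translate.
Qed.

Lemma test_cst (c : R) : test_function (cst c : 'rV[R]_d -> R).
Proof. by split => // k; exact: Ck_cst. Qed.

Lemma testD u w : test_function u -> test_function w ->
  test_function (fun x => u x + w x).
Proof.
move=> [pu Cu] [pw Cw]; split => [k x|k]; first by rewrite pu pw.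
exact: CkD.
Qed.

Lemma testM u w : test_function u -> test_function w ->
  test_function (fun x => u x * w x).
Proof.
move=> [pu Cu] [pw Cw]; split => [k x|k]; first by rewrite pu pw.
exact: CkM.
Qed.

Lemma testZ (c : R) u : test_function u -> test_function (fun x => c * u x).
Proof. by apply: testM; exact: test_cst. Qed.

Lemma testB u w : test_function u -> test_function w ->
  test_function (fun x => u x - w x).
Proof.
move=> tu tw; rewrite (_ : (fun _ => _) = (fun x => u x + -1 * w x)).
  by apply: testD => //; exact: testZ.
by apply/funext => x; rewrite mulN1r.
Qed.

Lemma test_expR u : test_function u -> test_function (fun x => expR (u x)).
Proof. by move=> [pu Cu]; split => [k x|k]; [rewrite pu|exact: Ck_expR]. Qed.

Lemma cosD2piz (x : R) (k : int) : cos (x + k%:~R * (pi *+ 2)) = cos x.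
Proof.
case: k => n; first by rewrite -pmulrn mulr_natl (periodicn (@cosD2pi R)).
rewrite -[LHS](periodicn (@cosD2pi R) n.+1); congr cos.
by rewrite NegzE mulrNz -pmulrn -[in X in _ + X]mulr_natl mulNr subrK.
Qed.

Lemma test_cos (j : 'I_d) (b : R) :
  test_function (fun y : 'rV[R]_d => cos ((pi *+ 2) * coor j y + b)).
Proof.
split => [k x|k]; last exact: Ck_cos_coor.
rewrite -[RHS](cosD2piz _ (k ord0 j)); congr cos.
by rewrite /coor !mxE; ring.
Qed.

Lemma test_translate u (y : 'rV[R]_d) : test_function u ->
  test_function (fun x => u (x + y)).
Proof.
move=> [pu Cu]; split => [k x|k]; last exact: Ck_translate.
by rewrite addrAC pu.
Qed.

Lemma test_derivable u (i : 'I_d) : test_function u ->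
  forall x, derivable u x (basis_vec i).
Proof. by move=> [_ Cu] x; have [_ /(_ i)[]] := Cu 1. Qed.

Lemma test_derive u (i : 'I_d) : test_function u ->
  test_function (fun x => 'D_(basis_vec i) u x).
Proof.
move=> [pu Cu]; split => [k x|k]; last by have [_ /(_ i)[]] := Cu k.+1.
rewrite -derive_translate (_ : (fun z => _) = u)//; apply/funext => y; exact: pu.
Qed.

Lemma test_continuous u : test_function u -> continuous u.
Proof. by move=> [_ /(_ 0)[]]. Qed.

Lemma test_measurable u : test_function u -> measurable_fun setT u.
Proof. by move=> /test_continuous; exact: continuous_rV_measurable. Qed.

(** Subtracting the floor of each coordinate brings any point into the compact cell [[0, 1]^d]
    without changing the value of [u]. *)
Lemma periodic_continuous_bounded u : Zd_periodic u -> continuous u ->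
  exists2 M, 0 < M & forall x, `|u x| <= M.
Proof.
move=> pu cu.
have cK : compact [set v : 'rV[R]_d | forall i, `[0, 1]%classic (v ord0 i)].
  by apply: (@rV_compact R d (fun=> `[0, 1]%classic)) => _; exact: segment_compact.
have cuK : {within [set v : 'rV[R]_d | forall i, `[0, 1]%classic (v ord0 i)], continuous u}.
  exact: continuous_subspaceT.
have /compact_bounded[M [_ HM]] := continuous_compact cuK cK.
exists (`|M| + 1); first by rewrite ltr_wpDl.
move=> x; rewrite -(pu (\row_i - Num.floor (x ord0 i)) x).
apply: (HM (`|M| + 1)); first by rewrite (le_lt_trans (ler_norm _))// ltrDl.
exists (x + map_mx intr (\row_i - Num.floor (x ord0 i))) => // i /=.
rewrite !mxE in_itv/= rmorphN/= subr_ge0 floor_le_tmp/= lerBlDl -(intrD _ _ 1).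
by rewrite ltW// floorD1_gt.
Qed.

Lemma test_bounded u : test_function u ->
  exists2 M, 0 < M & forall x, `|u x| <= M.
Proof.
by move=> tu; apply: periodic_continuous_bounded; [case: tu|exact: test_continuous].
Qed.

Lemma test_MVT u (i : 'I_d) (x : 'rV[R]_d) (t M : R) : test_function u ->
  (forall y, `|'D_(basis_vec i) u y| <= M) ->
  `|u (x + t *: basis_vec i) - u x| <= M * `|t|.
Proof.
move=> tu uM.
pose g (h : R) := u (x + h *: basis_vec i).
have dg (h : R) : is_derive h 1 g ('D_(basis_vec i) u (x + h *: basis_vec i)).
  by apply/is_derive_line/derivableP; exact: test_derivable.
have cg (a b : R) : {within `[a, b], continuous g}.
  by apply: derivable_within_continuous => y _; have [] := dg y.
have -> : u x = g 0 by rewrite /g scale0r addr0.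
have [t0|t0|->] := ltgtP t 0; last by rewrite subrr !normr0 mulr0.
- have [c _ E] := @MVT _ g _ _ _ t0 (fun h _ => dg h) (cg _ _).
  rewrite -/(g t) distrC E sub0r normrM normrN; exact: ler_wpM2r.
- have [c _ E] := @MVT _ g _ _ _ t0 (fun h _ => dg h) (cg _ _).
  rewrite -/(g t) E subr0 normrM; exact: ler_wpM2r.
Qed.

End Ck_algebra.

(** * Approximation of Borel sets by test functions *)

Section test_density.
Context {R : realType} {d : nat}.
Local Notation mu := (@torus_measure R d).
Local Notation U01 := (uniform_prob (@ltr01 R)).

(** The range condition on [phi] is carried along because the union step relies on it, and because
    it keeps the error below 1 when an unbounded weight is inserted later. *)
Definition test_approximable (A : set 'rV[R]_d) : Prop :=
  forall e : R, 0 < e -> exists phi : 'rV[R]_d -> R,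
    [/\ test_function phi, forall x, 0 <= phi x <= 1 &
      (\int[mu]_x (`|phi x - \1_A x|)%:E <= e%:E)%E].

Lemma test_approximable0 : test_approximable set0.
Proof.
move=> e e0; exists (cst 0); split; [exact: test_cst|by move=> x; rewrite lexx ler01|].
under eq_integral do rewrite indic0 subrr normr0.
by rewrite integral0 lee_fin ltW.
Qed.

Lemma test_approximableC A : test_approximable A -> test_approximable (~` A).
Proof.
move=> hA e e0; have [phi [tp p01 pe]] := hA e e0.
exists (fun x => 1 - phi x); split.
- by apply: testB => //; exact: (@test_cst R d 1).
- by move=> x; have := p01 x; lra.
- rewrite (le_trans _ pe)// le_eqVlt; apply/orP; left; apply/eqP.
  apply: eq_integral => x _; rewrite -normrN !indicE in_setC; congr (`|_|%:E).
  by case: (x \in A) => /=; lra.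
Qed.

Lemma measurable_abs_test_indic phi (A : set 'rV[R]_d) : test_function phi ->
  measurable A -> measurable_fun setT (fun x => (`|phi x - \1_A x|)%:E).
Proof.
move=> tp mA; apply/measurable_EFinP; apply: measurableT_comp => //.
by apply: measurable_funB; [exact: test_measurable|exact: measurable_indic].
Qed.

Lemma test_approximableU A B : measurable A -> measurable B ->
  test_approximable A -> test_approximable B -> test_approximable (A `|` B).
Proof.
move=> mA mB hA hB e e0; have e20 : 0 < e / 2 by rewrite divr_gt0.
have [f [tf f01 fe]] := hA _ e20; have [g [tg g01 ge]] := hB _ e20.
(* The same formula with indicators in place of [f] and [g] gives the indicator of the union; for
   values in [[0, 1]] its error is at most the sum of the two errors. *)
exists (fun x => 1 - (1 - f x) * (1 - g x)); split.
- apply: testB; first exact: (@test_cst R d 1).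
  by apply: testM; apply: testB => //; exact: (@test_cst R d 1).
- by move=> x; have := f01 x; have := g01 x; nra.
- rewrite (splitr e) EFinD; apply: le_trans (leeD fe ge).
  rewrite -ge0_integralD//; try exact: measurable_abs_test_indic.
  apply: ge0_le_integral => //.
  + apply: measurable_abs_test_indic; last exact: measurableU.
    apply: testB; first exact: (@test_cst R d 1).
    by apply: testM; apply: testB => //; exact: (@test_cst R d 1).
  + by apply: emeasurable_funD; exact: measurable_abs_test_indic.
  + move=> x _; rewrite -EFinD lee_fin.
    have := f01 x; have := g01 x; rewrite !indicE in_setU.
    have D (a : R) : 0 <= a <= 1 -> `|a - 1| = 1 - a.
      by move=> ?; rewrite distrC ger0_norm//; lra.
    have D0 (a : R) : 0 <= a <= 1 -> `|a - 0| = a.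
      by move=> /andP[? _]; rewrite subr0 ger0_norm.
    move=> gx fx.
    have hx : 0 <= 1 - (1 - f x) * (1 - g x) <= 1 by nra.
    by case: (x \in A); case: (x \in B); rewrite /= ?D ?D0//; nra.
Qed.

(** By continuity from below, a finite union misses at most [e / 2] of the measure; a test function
    within [e / 2] of that finite union then serves for the whole. *)
Lemma test_approximable_bigcup (F : (set 'rV[R]_d)^nat) :
  (forall i, measurable (F i)) -> (forall i, test_approximable (F i)) ->
  test_approximable (\bigcup_i F i).
Proof.
move=> mF hF e e0.
pose G n := \big[setU/set0]_(i < n.+1) F i.
have mG n : measurable (G n) by exact: bigsetU_measurable.
have hG n : test_approximable (G n).
  rewrite /G; elim: n => [|n IH]; first by rewrite big_ord1.
  by rewrite big_ord_recr/=; apply: test_approximableU => //; exact: mG.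
have GE : \bigcup_n G n = \bigcup_i F i by exact: bigcup_bigsetU_bigcup.
have mU : measurable (\bigcup_i F i) by exact: bigcup_measurable.
have cG : (mu \o G) x @[x --> \oo] --> mu (\bigcup_n G n).
  apply: nondecreasing_cvg_mu => //; first by rewrite GE.
  move=> m n mn; apply/subsetPset; by apply: subset_bigsetU; rewrite ltnS.
have e20 : 0 < e / 2 by rewrite divr_gt0.
have [n nE] : exists n, (mu (\bigcup_i F i `\` G n) <= (e / 2)%:E)%E.
  have fU := fin_num_measure mu _ mU.
  move: cG; rewrite GE -(fineK fU) => /fine_cvgP[_] /cvgrPdist_le.
  move=> /(_ _ e20) [n _ /(_ n (leqnn n))] /= H.
  exists n; have GU : G n `<=` \bigcup_i F i by rewrite -GE; exact: bigcup_sup.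
  rewrite measureD//; last by rewrite ltey_eq fU.
  rewrite setIidr// -(fineK fU) -(fineK (fin_num_measure mu _ (mG n))) -EFinB lee_fin.
  exact: le_trans (ler_norm _) H.
have [f [tf f01 fe]] := hG n _ e20.
exists f; split => //.
rewrite (splitr e) EFinD; apply: le_trans (leeD fe nE).
have mD : measurable (\bigcup_i F i `\` G n) by exact: measurableD.
rewrite -(setIT (_ `\` _)) -integral_indic// -ge0_integralD//; last 2 first.
- exact: measurable_abs_test_indic.
- exact/measurable_EFinP/measurable_indic.
apply: ge0_le_integral => //.
- exact: measurable_abs_test_indic.
- apply: emeasurable_funD; first exact: measurable_abs_test_indic.
  exact/measurable_EFinP/measurable_indic.
- move=> x _; rewrite -EFinD lee_fin.
  have GU : G n `<=` \bigcup_i F i by rewrite -GE; exact: bigcup_sup.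
  rewrite !indicE.
  case: (boolP (x \in G n)) => xG.
    rewrite [_ \in _ `\` _]memNset; last by move=> []; move/set_mem : xG.
    by rewrite mem_set ?addr0//; exact/GU/set_mem.
  case: (boolP (x \in \bigcup_i F i)) => xU; last first.
    by rewrite [_ \in _ `\` _]memNset ?addr0// => -[/mem_set]; rewrite (negbTE xU).
  rewrite mem_set; last by split; [exact/set_mem|move=> /mem_set; rewrite (negbTE xG)].
  have fx := f01 x; rewrite /= subr0 (ger0_norm (x := f x)); last by lra.
  by rewrite distrC ger0_norm; lra.
Qed.

(** With the next lemma, this makes [exp (- exp (- n q))] a smooth step function of [q]. Two uses of
    [1 + x <= exp x] give [n (- q) <= exp (exp (- n q))], hence the explicit threshold on [n]. *)
Lemma expR_expR_cvg0 (q : R) : q < 0 ->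
  expR (- expR (- (n%:R * q))) @[n --> \oo] --> (0 : R).
Proof.
move=> q0; have nq : 0 < - q by rewrite oppr_gt0.
apply/cvgrPdist_le => e e0; near=> n; rewrite sub0r normrN ger0_norm ?expR_ge0//.
have n0 : (0 < n)%N by near: n; exact: nbhs_infty_gt.
have H : (e * - q)^-1 <= n%:R by near: n; exact: nbhs_infty_ger.
have H1 : e^-1 <= n%:R * - q.
  by rewrite -ler_pdivrMr// -invfM.
have H2 : n%:R * - q <= expR (- (n%:R * q)).
  by rewrite -mulrN; apply: le_trans (expR_ge1Dx _); rewrite lerDr.
have H3 : expR (- (n%:R * q)) <= expR (expR (- (n%:R * q))).
  by apply: le_trans (expR_ge1Dx _); rewrite lerDr.
rewrite expRN invf_ple ?posrE ?expR_gt0//.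
exact: le_trans H1 (le_trans H2 H3).
Unshelve. all: by end_near. Qed.

Lemma expR_expR_cvg1 (q : R) : 0 < q ->
  expR (- expR (- (n%:R * q))) @[n --> \oo] --> (1 : R).
Proof.
move=> q0.
rewrite -[X in _ --> X]expR0 -[in X in _ --> X]oppr0.
apply: (@cvg_comp _ _ _ (fun n : nat => expR (- (n%:R * q)))
  (fun x : R => expR (- x)) _ (nbhs (0 : R))); last first.
  by apply: (@continuous_comp _ _ _ -%R); [exact: opp_continuous|exact: continuous_expR].
apply/cvgrPdist_le => e e0; near=> n; rewrite sub0r normrN ger0_norm ?expR_ge0//.
have H : (e * q)^-1 <= n%:R by near: n; exact: nbhs_infty_ger.
have H1 : e^-1 <= n%:R * q by rewrite -ler_pdivrMr// -invfM.
rewrite expRN invf_ple ?posrE ?expR_gt0//; apply: le_trans H1 _.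
by apply: le_trans (expR_ge1Dx _); rewrite lerDr.
Unshelve. all: by end_near. Qed.

Lemma torus_coor_ae (i : 'I_d) (P : R -> Prop) (N : set R) :
  measurable N -> lebesgue_measure N = 0%E ->
  (forall x : R, 0 < x < 1 -> ~ N x -> P x) ->
  {ae mu, forall x, P (coor i x)}.
Proof.
move=> mN N0 HP.
pose N' : set (measurableTypeR R) := N `|` ~` `]0, 1[%classic.
have mN' : measurable N'.
  by apply: measurableU => //; apply: measurableC; exact: measurable_itv.
exists (coor i @^-1` N'); split.
- by rewrite -[X in measurable X]setTI; exact: measurable_coor.
- rewrite torus_measure_coor//=.
  have mC : measurable (~` `]0, 1[%classic : set (measurableTypeR R)).
    by apply: measurableC; exact: measurable_itv.
  apply/eqP; rewrite -measure_le0; apply: (le_trans (measureU2 U01 mN mC)).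
  have /null_content_dominatesP/(_ N mN N0) /= -> := dominates_uniform_prob (@ltr01 R).
  rewrite add0e; have := @probability_setC _ _ _ U01 _ (measurable_itv `]0, 1[%R).
  move=> /= ->; rewrite /uniform_prob integral_uniform_pdf.
  rewrite (_ : _ `&` _ = `]0, 1[%classic); last first.
    apply/seteqP; split => x /=; rewrite !in_itv/=; first by case.
    by move=> /[dup] /andP[/ltW -> /ltW ->].
  rewrite (eq_integral (fun=> 1%E)); last first.
    move=> x; rewrite inE/= in_itv/= => /andP[/ltW x0 /ltW x1].
    by rewrite /uniform_pdf x0 x1 subr0 invr1.
  by rewrite integral_cst//= lebesgue_measure_itv/= lte_fin ltr01 mul1e sube0 subee.
- move=> x /= nP; rewrite /N' /=; apply: contrapT => /not_orP[nN /contrapT].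
  by rewrite in_itv/= => H; apply: nP; exact: HP.
Qed.

Lemma test_approximable_halfline (i : 'I_d) (a : R) :
  test_approximable [set x | a < coor i x].
Proof.
move=> e e0.
(* For [x] in []0, 1[], the condition [a < x] is equivalent to [b < x]. Clamping also gives
   [|x - b| < 1], so that [sin (pi (x - b))] has the sign of [x - b]; the excluded points 0, 1 and
   [b] are null. *)
pose b := Num.max 0 (Num.min a 1).
have b0 : 0 <= b by rewrite le_max lexx.
have b1 : b <= 1 by rewrite ge_max ler01 ge_min lexx orbT.
(* [q] is smooth and periodic, and on ]0, 1[ it has the sign of [x - b]. *)
pose q (x : R) := cos (pi * b) - cos ((pi *+ 2) * x - pi * b).
have qE x : q x = 2 * (sin (pi * (x - b)) * sin (pi * x)).
  have -> : q x = cos (pi * (x - b) - pi * x) - cos (pi * (x - b) + pi * x).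
    rewrite /q; congr (_ - cos _); last by ring.
    by rewrite -cosN; congr cos; ring.
  by rewrite cosB cosD; ring.
have sx x : 0 < x < 1 -> 0 < sin (pi * x).
  move=> /andP[x0 x1]; apply: sin_gt0_pi.
  by rewrite mulr_gt0 ?pi_gt0//= -[ltRHS]mulr1 ltr_pM2l ?pi_gt0.
pose phi (n : nat) (x : 'rV[R]_d) := expR (- expR (- (n%:R * q (coor i x)))).
have tphi n : test_function (phi n).
  have tq : test_function (fun x : 'rV[R]_d => q (coor i x)).
    by apply: testB; [exact: test_cst|exact: test_cos].
  rewrite (_ : phi n = (fun x => expR (-1 * expR ((- n%:R) * q (coor i x))))).
    by apply/test_expR/testZ/test_expR/testZ.
  by apply/funext => x; rewrite mulN1r mulNr.
have phi01 n x : 0 <= phi n x <= 1.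
  by rewrite expR_ge0/= -[leRHS]expR0 ler_expR oppr_le0 expR_ge0.
pose A := [set x : 'rV[R]_d | a < coor i x].
have mA : measurable A.
  rewrite -[X in measurable X]setTI (_ : A = coor i @^-1` `]a, +oo[%classic).
    by apply: measurable_coor => //; exact: measurable_itv.
  by apply/seteqP; split => x /=; rewrite in_itv/= andbT.
have cphi : {ae mu, forall x, setT x -> (phi n x)%:E @[n --> \oo] --> (\1_A x)%:E}.
  pose P (x : R) := expR (- expR (- (n%:R * q x))) @[n --> \oo] --> ((a < x)%R%:R : R).
  have : {ae mu, forall x, P (coor i x)}.
    apply: (@torus_coor_ae i P [set b]) => //; first exact: lebesgue_measure_set1.
    move=> x x01 /eqP xb; rewrite /P.
    move: (xb); rewrite neq_lt => /orP[xb'|xb'].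
    - have -> : (a < x) = false.
        apply/negbTE; rewrite -leNgt; move: xb'; rewrite lt_max => /orP[|]; last first.
          by rewrite lt_min => /andP[/ltW].
        by case/andP: x01 => x0 _ /(lt_trans x0); rewrite ltxx.
      apply: expR_expR_cvg0; rewrite qE pmulr_rlt0// pmulr_llt0 ?sx//.
      have : 0 < sin (pi * (b - x)) by apply: sx; rewrite subr_gt0 xb'/=; case/andP: x01; lra.
      by rewrite -oppr_lt0 -sinN; congr (sin _ < 0); ring.
    - have -> : a < x = true.
        move: xb'; rewrite gt_max => /andP[_]; rewrite gt_min => /orP[//|].
        by case/andP: x01 => _ x1 /(lt_trans x1); rewrite ltxx.
      apply: expR_expR_cvg1; rewrite qE pmulr_rgt0// pmulr_lgt0 ?sx//.
      by rewrite subr_gt0 xb'/=; case/andP: x01; lra.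
  apply: filterS => x Px _; apply: cvg_EFin; first exact: nearW.
  have -> : (\1_A x : R) = (a < coor i x)%R%:R.
    rewrite indicE; case: (boolP (x \in A)) => [/set_mem /= ->//|].
    by rewrite notin_setE => /negP/negbTE ->.
  exact: Px.
have mphi n : measurable_fun setT (fun x => (phi n x)%:E).
  by apply/measurable_EFinP; exact: test_measurable.
have le1 : {ae mu, forall x n, setT x -> (`|(phi n x)%:E| <= (cst 1%E : _ -> \bar R) x)%E}.
  apply: aeW => x n _; have := phi01 n x; rewrite lee_fin => /andP[p0 p1].
  by rewrite ger0_norm.
have mfA : measurable_fun setT (fun x => (\1_A x : R)%:E).
  exact/measurable_EFinP/measurable_indic.
have [_ + _] := dominated_convergence measurableT mphi mfA cphi
  (finite_measure_integrable_cst mu 1 measurableT) le1.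
move=> /fine_cvgP[fin] /cvgrPdist_le /(_ _ e0) near_e.
have [n _ /(_ n (leqnn n)) [/= fn en]] := filterI fin near_e.
exists (phi n); split => //.
rewrite -(fineK fn) lee_fin; apply: le_trans en.
by rewrite sub0r normrN ler_norm.
Qed.

(** The approximable measurable sets form a sigma-algebra. This is used twice: on [R^d], to reduce
    to coordinate preimages, and on the line, to reduce these to preimages of half-lines. *)
Lemma measurable_test_approximable (A : set 'rV[R]_d) : measurable A -> test_approximable A.
Proof.
pose D := [set A : set 'rV[R]_d | measurable A /\ test_approximable A].
suff : measurable `<=` D by move=> H /H[].
apply: smallest_sub.
  split.
  - by split => //; exact: test_approximable0.
  - move=> B [mB aB]; rewrite setTD; split; first exact: measurableC.
    exact: test_approximableC.
  - move=> F FD; split; first by apply: bigcup_measurable => k _; case: (FD k).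
    by apply: test_approximable_bigcup => k; case: (FD k).
elim/big_ind: _ => // [X Y XD YD|i _]; first by rewrite subUset.
pose E := [set B : set (measurableTypeR R) | D (coor i @^-1` B)].
suff : measurable `<=` E by move=> H _ [B mB <-]; rewrite setTI; exact: H.
have -> : (measurable : set (set (measurableTypeR R))) =
    <<s @RGenOInfty.G R >> by exact: RGenOInfty.measurableE.
apply: smallest_sub.
  split.
  - by split; rewrite preimage_set0 => //; exact: test_approximable0.
  - move=> B [mB aB]; rewrite /E /= setTD preimage_setC; split; first exact: measurableC.
    exact: test_approximableC.
  - move=> F FD; rewrite /E /= preimage_bigcup; split.
      by apply: bigcup_measurable => k _; case: (FD k).
    by apply: test_approximable_bigcup => k; case: (FD k).
move=> _ [a ->]; split.
  by rewrite -[X in measurable X]setTI; apply: measurable_coor => //; exact: measurable_itv.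
rewrite (_ : _ @^-1` _ = [set x | a < coor i x]); first exact: test_approximable_halfline.
by apply/seteqP; split => x /=; rewrite in_itv/= andbT.
Qed.

End test_density.

(** * Integrable functions on the torus *)

Section real_integrable.
Context dT (T : measurableType dT) {R : realType} (P : probability T R).
Implicit Types u w v : T -> R.

Local Notation L1 u := (P.-integrable setT (EFin \o u)).

Lemma L1_measurable u : L1 u -> measurable_fun setT u.
Proof. by move=> /integrableP[/measurable_EFinP]. Qed.

Lemma L1D u w : L1 u -> L1 w -> L1 (fun x => u x + w x).
Proof. by move=> iu iw; exact: (integrableD measurableT iu iw). Qed.

Lemma L1B u w : L1 u -> L1 w -> L1 (fun x => u x - w x).
Proof.
by move=> iu iw; exact: (integrableB measurableT iu iw).
Qed.

Lemma L1Z c u : L1 u -> L1 (fun x => c * u x).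
Proof. by move=> iu; exact: (integrableZl measurableT c iu). Qed.

Lemma L1_norm u : L1 u -> L1 (fun x => `|u x|).
Proof. exact: integrable_norm. Qed.

Lemma L1_le u w : measurable_fun setT u -> (forall x, `|u x| <= `|w x|) ->
  L1 w -> L1 u.
Proof.
move=> mu uw; apply: le_integrable => //; first exact/measurable_EFinP.
by move=> x _; rewrite lee_fin.
Qed.

Lemma L1_bounded u M : measurable_fun setT u -> (forall x, `|u x| <= M) -> L1 u.
Proof.
move=> mu uM; apply: (@L1_le u (cst M)) => //.
  by move=> x; apply: le_trans (uM x) (ler_norm _).
exact: finite_measure_integrable_cst.
Qed.

Lemma L1_mul_bounded u w M : L1 u -> measurable_fun setT w ->
  (forall x, `|w x| <= M) -> L1 (fun x => u x * w x).
Proof.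
move=> iu mw wM; apply: (@L1_le _ (fun x => M * u x)).
- by apply: measurable_funM => //; exact: L1_measurable.
- by move=> x; rewrite !normrM mulrC ler_wpM2r// (le_trans (wM x))// ler_norm.
- exact: L1Z.
Qed.

Lemma L1_ae u w : measurable_fun setT w -> L1 u ->
  {ae P, forall x, u x = w x} -> L1 w.
Proof.
move=> mw iu uw; have mu := L1_measurable iu.
apply/integrableP; split; first exact/measurable_EFinP.
have /integrableP[_] := iu.
rewrite (ge0_ae_eq_integral (g := fun x => `|(w x)%:E|%E))//.
- by apply: measurableT_comp => //; exact/measurable_EFinP.
- by apply: measurableT_comp => //; exact/measurable_EFinP.
- by apply: filterS uw => x /= -> _.
Qed.

Lemma ae_eq_Rintegral u w : measurable_fun setT u -> measurable_fun setT w ->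
  {ae P, forall x, u x = w x} -> \int[P]_x u x = \int[P]_x w x.
Proof.
move=> mu mw uw; congr fine; apply: ae_eq_integral => //; [exact/measurable_EFinP..|].
by apply: filterS uw => x /= -> _.
Qed.

Lemma le_Rint u w : L1 u -> L1 w -> (forall x, u x <= w x) ->
  \int[P]_x u x <= \int[P]_x w x.
Proof. by move=> iu iw uw; apply: le_Rintegral => // x _. Qed.

Lemma RintD u w : L1 u -> L1 w ->
  \int[P]_x (u x + w x) = \int[P]_x u x + \int[P]_x w x.
Proof. exact: RintegralD. Qed.

Lemma RintB u w : L1 u -> L1 w ->
  \int[P]_x (u x - w x) = \int[P]_x u x - \int[P]_x w x.
Proof. exact: RintegralB. Qed.

Lemma RintZ c u : L1 u -> \int[P]_x (c * u x) = c * \int[P]_x u x.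
Proof. exact: RintegralZl. Qed.

Lemma le_norm_Rint u : L1 u -> `|\int[P]_x u x| <= \int[P]_x `|u x|.
Proof. exact: le_normr_Rintegral. Qed.

Lemma Rint_cst (c : R) : \int[P]_x c = c.
Proof.
rewrite Rintegral_cst// [X in fine X](_ : _ = 1%E) ?mulr1//.
exact: probability_setT.
Qed.

Lemma Rint_norm_ge0 u : 0 <= \int[P]_x `|u x|.
Proof. by apply: Rintegral_ge0. Qed.

Lemma Rint_norm_triangle u v w : L1 u -> L1 v -> L1 w ->
  \int[P]_x `|u x - w x| <= \int[P]_x `|u x - v x| + \int[P]_x `|v x - w x|.
Proof.
move=> iu iv iw; have iuv := L1_norm (L1B iu iv); have ivw := L1_norm (L1B iv iw).
rewrite -RintD//; apply: le_Rint; [exact/L1_norm/L1B|exact: L1D|].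
by move=> x; rewrite -[X in `|X|](subrKA (v x)) ler_normD.
Qed.

Lemma EFin_Rint_norm u : L1 u ->
  (\int[P]_x `|u x|)%:E = (\int[P]_x (`|u x|)%:E)%E.
Proof. by move=> /L1_norm iu; rewrite fineK//; exact: (integrable_fin_num measurableT iu). Qed.

(** By monotone convergence the sum of the [|g n|] has integral at most 1, the total of the bounds,
    and is therefore finite almost everywhere. *)
Lemma ae_cvg_series (g : nat -> T -> R) : (forall n, L1 (g n)) ->
  (forall n, \int[P]_x `|g n x| <= 1 / (2 ^ n.+1)%:R) ->
  {ae P, forall x, cvgn (series (fun n => `|g n x|))}.
Proof.
move=> ig gle.
pose h n x := (`|g n x|)%:E.
have mh n : measurable_fun setT (h n).
  exact/measurable_EFinP/L1_measurable/L1_norm.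
have h0 n x : (0 <= h n x)%E by rewrite lee_fin.
have sg : (\int[P]_x (\sum_(n <oo) h n x) <= 1)%E.
  rewrite integral_nneseries//.
  apply: le_trans (epsilon_trick0 xpredT (@ler01 R)).
  apply: lee_nneseries => n _; first by move=> _; exact: integral_ge0.
  by rewrite -EFin_Rint_norm// lee_fin.
have isg : P.-integrable setT (fun x => \sum_(n <oo) h n x)%E.
  apply/integrableP; split; first exact: ge0_emeasurable_sum.
  under eq_integral => x _ do rewrite gee0_abs ?nneseries_ge0//.
  by rewrite (le_lt_trans sg)// ltry.
have := integrable_ae measurableT isg.
apply: filterS => x /(_ Logic.I) fx; apply/cvg_ex.
exists (fine (\sum_(n <oo) h n x)%E).
have := @is_cvg_nneseries R (fun n => h n x) predT 0 (fun n _ _ => h0 n x).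
rewrite -(fineK fx) => /fine_cvgP[_].
by under eq_fun do rewrite /= sumEFin.
Qed.

(** Indices are chosen so that the L^1 errors are summable. The selection [s] need not be
    increasing: [n <= s n] is enough to carry limits along it. *)
Lemma cvg_L1_ae_subseq (u_ : nat -> T -> R) u :
  (forall n, L1 (u_ n)) -> L1 u ->
  \int[P]_x `|u_ n x - u x| @[n --> \oo] --> 0 ->
  exists s : nat -> nat, (forall n, (n <= s n)%N) /\
    {ae P, forall x, u_ (s n) x @[n --> \oo] --> u x}.
Proof.
move=> iu_ iu cu.
have /choice[s sP] : forall n : nat, exists m, (n <= m)%N /\
    \int[P]_x `|u_ m x - u x| <= 1 / (2 ^ n.+1)%:R.
  move=> n; have e0 : 0 < (1 / (2 ^ n.+1)%:R : R) by rewrite divr_gt0// ltr0n expn_gt0.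
  have /cvgrPdist_le/(_ _ e0) [m _ /(_ (maxn n m) (leq_maxr _ _))/= H] := cu.
  exists (maxn n m); split; first exact: leq_maxl.
  by apply: le_trans H; rewrite sub0r normrN ler_norm.
exists s; split; first by move=> n; have [] := sP n.
have := @ae_cvg_series (fun n x => u_ (s n) x - u x) (fun n => L1B (iu_ _) iu)
  (fun n => (sP n).2).
apply: filterS => x /cvg_series_cvg_0 cx.
apply/cvgrPdist_le => e e0; have /cvgrPdist_le/(_ _ e0) := cx.
by apply: filterS => n; rewrite sub0r normrN normr_id distrC.
Qed.

End real_integrable.

(** * Density, duality and continuity of translations in L^1 *)

Section torus_L1.
Import HBSimple.
Context {R : realType} {d : nat}.
Local Notation mu := (@torus_measure R d).
Local Notation L1 u := (mu.-integrable setT (EFin \o u)).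
Implicit Types u w v phi : 'rV[R]_d -> R.

Lemma test_L1 phi : test_function phi -> L1 phi.
Proof.
move=> tp; have [M _ pM] := test_bounded tp.
by apply: (@L1_bounded _ _ _ _ _ M) => //; exact: test_measurable.
Qed.

Lemma L1_mul_test u phi : L1 u -> test_function phi -> L1 (fun x => u x * phi x).
Proof.
move=> iu tp; have [M _ pM] := test_bounded tp.
by apply: (@L1_mul_bounded _ _ _ _ _ _ M) => //; exact: test_measurable.
Qed.

Lemma Rint_torus_translate (i : 'I_d) (r : R) u : measurable_fun setT u ->
  Zd_periodic u ->
  \int[mu]_x u (x + r *: basis_vec i) = \int[mu]_x u x.
Proof.
move=> mu_ pu; congr fine; apply: (@integral_torus_translate R d i r (EFin \o u)).
  exact/measurable_EFinP.
by move=> k x /=; rewrite pu.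
Qed.

Lemma L1_translate (i : 'I_d) (r : R) u : Zd_periodic u -> L1 u ->
  L1 (fun x => u (x + r *: basis_vec i)).
Proof.
move=> pu iu; have mu_ := L1_measurable iu.
apply/integrableP; split.
  apply/measurable_EFinP; apply: (measurableT_comp mu_); exact: measurable_translate.
rewrite (@integral_torus_translate R d i r (fun x => `|(u x)%:E|%E)).
- by have /integrableP[] := iu.
- by apply: measurableT_comp => //; exact/measurable_EFinP.
- by move=> k x; rewrite pu.
Qed.

(** The functions that can be approximated form a vector space [V] containing the indicators, hence
    the simple functions, which are dense in L^1. *)
Lemma L1_test_dense u (e : R) : L1 u -> 0 < e ->
  exists2 phi, test_function phi & \int[mu]_x `|phi x - u x| <= e.
Proof.
pose V v := L1 v /\ forall e : R, 0 < e ->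
  exists2 phi, test_function phi & \int[mu]_x `|phi x - v x| <= e.
have Vind A : measurable A -> V (\1_A).
  move=> mA; have iA : L1 (\1_A : _ -> R) by exact: integrable_indic.
  split => // c c0; have [phi [tp _ pe]] := measurable_test_approximable mA c0.
  exists phi => //.
  by rewrite -lee_fin EFin_Rint_norm//; apply: L1B => //; exact: test_L1.
have VD v w : V v -> V w -> V (fun x => v x + w x).
  move=> [iv hv] [iw hw]; split; first exact: L1D.
  move=> c c0; have c20 : 0 < c / 2 by rewrite divr_gt0.
  have [f tf fc] := hv _ c20; have [g tg gc] := hw _ c20.
  exists (fun x => f x + g x); first exact: testD.
  have if_ := test_L1 tf; have ig := test_L1 tg.
  rewrite (splitr c); apply: le_trans (lerD fc gc).
  rewrite -RintD; [|exact/L1_norm/L1B..].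
  apply: le_Rint; [by apply/L1_norm/L1B; exact: L1D|by apply: L1D; exact/L1_norm/L1B|].
  by move=> x; rewrite opprD addrACA ler_normD.
have VZ k v : V v -> V (fun x => k * v x).
  move=> [iv hv]; split; first exact: L1Z.
  move=> c c0; have k0 : 0 < `|k| + 1 by rewrite ltr_wpDl.
  have [f tf fc] := hv (c / (`|k| + 1)) (divr_gt0 c0 k0).
  exists (fun x => k * f x); first exact: testZ.
  have if_ := test_L1 tf.
  apply: le_trans (_ : `|k| * (c / (`|k| + 1)) <= _); last first.
    by rewrite mulrCA ger_pMr// ler_pdivrMr// mul1r lerDl.
  apply: le_trans (ler_wpM2l (normr_ge0 k) fc).
  rewrite -RintZ; last exact/L1_norm/L1B.
  apply: le_Rint; [by apply/L1_norm/L1B; exact: L1Z|by apply: L1Z; exact/L1_norm/L1B|].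
  by move=> x; rewrite -mulrBr normrM.
have V0 : V (fun=> 0).
  by rewrite (_ : (fun=> 0) = \1_set0); [exact: Vind|apply/funext => x; rewrite indicE in_set0].
move=> iu e0.
have [g_ [ig _ +]] := approximation_sfun_integrable measurableT iu.
have e20 : 0 < e / 2 by rewrite divr_gt0.
move=> /fine_cvgP[fin] /cvgrPdist_le /(_ _ e20) near_e.
have [n _ /(_ n (leqnn n)) [/= fn en]] := filterI fin near_e.
have Vsum (s : seq R) : V (fun x => \sum_(y <- s) y * \1_(g_ n @^-1` [set y]) x).
  elim: s => [|y s IH]; first by under eq_fun do rewrite big_nil.
  under eq_fun do rewrite big_cons.
  by apply: VD => //; apply: VZ; apply: Vind; exact: measurable_sfunP.
have Vg : V (g_ n).
  have -> : (g_ n : _ -> R) = (fun x => \sum_(y <- finmap.enum_fset (fset_set (range (g_ n))))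
      y * \1_(g_ n @^-1` [set y]) x).
    by apply/funext => x; rewrite fimfunE fsbig_finite.
  exact: Vsum.
have [f tf fe] := Vg.2 _ e20.
exists f => //.
rewrite (splitr e); apply: le_trans (Rint_norm_triangle (test_L1 tf) (ig n) iu) _.
apply: lerD => //.
apply: le_trans en; rewrite sub0r normrN; apply: le_trans (ler_norm _).
rewrite le_eqVlt; apply/orP; left; apply/eqP; congr fine.
by apply: eq_integral => x _; rewrite /= distrC.
Qed.

(** The weight [v] may be unbounded. Replacing it by a test function [f] costs [e / 2], since
    [|phi - 1_A| <= 1]; a bound [M] of [f] then fixes the accuracy [e / 2 / M] asked of [phi]. *)
Lemma weighted_test_approx v A (e : R) : L1 v -> measurable A -> 0 < e ->
  exists phi, [/\ test_function phi, forall x, 0 <= phi x <= 1 &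
    \int[mu]_x (`|v x| * `|phi x - \1_A x|) <= e].
Proof.
move=> iv mA e0; have e20 : 0 < e / 2 by rewrite divr_gt0.
have [f tf fe] := L1_test_dense iv e20.
have [M M0 fM] := test_bounded tf.
have [phi [tp p01 pe]] := measurable_test_approximable mA (divr_gt0 e20 M0).
exists phi; split => //.
have ip := test_L1 tp; have if_ := test_L1 tf.
have iA : L1 (\1_A : _ -> R) by exact: integrable_indic.
have idiff := L1B ip iA.
have {}pe : \int[mu]_x `|phi x - \1_A x| <= e / 2 / M.
  by rewrite -lee_fin EFin_Rint_norm.
have d1 x : `|phi x - \1_A x| <= 1.
  have := p01 x; rewrite indicE; case: (x \in A) => /= fx.
    by rewrite distrC ger0_norm; lra.
  by rewrite subr0 ger0_norm; lra.
have md : measurable_fun setT (fun x => `|phi x - \1_A x|).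
  by apply: (@L1_measurable _ _ _ mu); exact: L1_norm.
rewrite (splitr e); apply: le_trans (lerD fe (_ : M * (e / 2 / M) <= _)); last first.
  by rewrite mulrC divfK// gt_eqF.
apply: le_trans (_ : \int[mu]_x (`|f x - v x| + M * `|phi x - \1_A x|) <= _); last first.
  rewrite RintD; [|exact/L1_norm/L1B|exact/L1Z/L1_norm].
  by rewrite lerD2l RintZ; [rewrite ler_wpM2l// ltW|exact: L1_norm].
apply: le_Rint.
- apply: (@L1_mul_bounded _ _ _ _ _ _ 1) => //; first exact: L1_norm.
  by move=> x; rewrite normr_id.
- by apply: L1D; [exact/L1_norm/L1B|exact/L1Z/L1_norm].
- move=> x; apply: le_trans (_ : (`|f x - v x| + `|f x|) * `|phi x - \1_A x| <= _).
    by rewrite ler_wpM2r// -lerBlDr -(normrN (_ - _)) opprB; exact: lerB_dist.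
  by rewrite mulrDl lerD ?ler_piMr// ler_wpM2r.
Qed.

(** The sign of [v] is [2 1_A - 1] with [A] the set where [v >= 0]. It is approximated by
    [2 psi - 1], with the error measured against the weight [|v|]. *)
Lemma L1_norm_dual v (C : R) : L1 v ->
  (forall phi, test_function phi -> (forall x, `|phi x| <= 1) ->
    \int[mu]_x (v x * phi x) <= C) ->
  \int[mu]_x `|v x| <= C.
Proof.
move=> iv H; apply/ler_addgt0Pr => e e0.
pose A := [set x | 0 <= v x].
have mA : measurable A.
  rewrite -[X in measurable X]setTI (_ : A = v @^-1` `[0, +oo[%classic).
    by apply: (L1_measurable iv) => //; exact: measurable_itv.
  by apply/seteqP; split => x /=; rewrite in_itv/= andbT.
have e20 : 0 < e / 2 by rewrite divr_gt0.
have [psi [tp p01 pe]] := weighted_test_approx iv mA e20.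
pose phi x := 2 * psi x - 1.
have tphi : test_function phi.
  by apply: testB; [exact: testZ|exact: (@test_cst R d 1)].
have phi1 x : `|phi x| <= 1 by have := p01 x; rewrite ler_norml /phi; lra.
have md : measurable_fun setT (fun x => `|psi x - \1_A x|).
  by apply: L1_measurable; apply/L1_norm/L1B; [exact: test_L1|exact: integrable_indic].
have iw : L1 (fun x => `|v x| * `|psi x - \1_A x|).
  apply: (@L1_mul_bounded _ _ _ _ _ _ 1) => //; first exact: L1_norm.
  move=> x; rewrite normr_id; have := p01 x; rewrite indicE; case: (x \in A) => /= fx.
    by rewrite distrC ger0_norm; lra.
  by rewrite subr0 ger0_norm; lra.
apply: le_trans (lerD (H _ tphi phi1) (_ : 2 * (e / 2) <= _)); last by lra.
apply: (@le_trans _ _ (\int[mu]_x (v x * phi x) +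
    2 * \int[mu]_x (`|v x| * `|psi x - \1_A x|))); last by rewrite lerD2l ler_wpM2l.
have ivp := L1_mul_test iv tphi.
rewrite -RintZ// -RintD//; last exact: L1Z.
apply: le_Rint; [exact: L1_norm|by apply: L1D => //; exact: L1Z|].
move=> x; rewrite indicE /phi.
have px := p01 x; case: (boolP (x \in A)) => [/set_mem /= vx|].
  by rewrite ger0_norm// distrC ger0_norm /=; [nra|lra].
rewrite notin_setE /= => /negP; rewrite -ltNge => vx.
by rewrite ltr0_norm// subr0 ger0_norm /=; [nra|lra].
Qed.

(** Three errors of [e / 3]: invariance makes the approximation error by [phi] the same before and
    after the shift, and the mean value theorem handles [phi] itself. *)
Lemma L1_translate_cvg (i : 'I_d) v (e : R) : Zd_periodic v -> L1 v -> 0 < e ->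
  exists2 r : R, 0 < r & forall t, `|t| <= r ->
    \int[mu]_x `|v (x + t *: basis_vec i) - v x| <= e.
Proof.
move=> pv iv e0; have e30 : 0 < e / 3 by rewrite divr_gt0.
have [phi tp pe] := L1_test_dense iv e30.
have [M M0 pM] := test_bounded (test_derive i tp).
exists (e / 3 / M); first by rewrite divr_gt0.
move=> t tr; have ip := test_L1 tp.
have ivt := @L1_translate i t _ pv iv.
have ipt := test_L1 (test_translate (t *: basis_vec i) tp).
apply: le_trans (Rint_norm_triangle ivt ipt iv) _.
apply: le_trans (lerD (lexx _) (Rint_norm_triangle ipt ip iv)) _.
have -> : e = e / 3 + (e / 3 + e / 3) by lra.
apply: lerD; last apply: lerD => //.
- rewrite (@Rint_torus_translate i t (fun x => `|v x - phi x|)).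
  + by under eq_Rintegral do rewrite distrC.
  + by apply: (@L1_measurable _ _ _ mu); exact/L1_norm/L1B.
  + by move=> k x; rewrite pv (tp.1 k).
- apply: le_trans (_ : \int[mu]_x (M * `|t|) <= _).
    apply: le_Rint; [exact/L1_norm/L1B|exact: finite_measure_integrable_cst|].
    by move=> x; exact: test_MVT.
  by rewrite Rint_cst mulrC -ler_pdivlMr.
Qed.

End torus_L1.

(** * Weak derivatives *)

Section weak_derivatives.
Context {R : realType} {d : nat}.
Local Notation mu := (@torus_measure R d).
Local Notation L1 u := (mu.-integrable setT (EFin \o u)).
Implicit Types u w v phi f : 'rV[R]_d -> R.

Lemma is_wpartial_L1 i u w : is_wpartial i u w ->
  [/\ Zd_periodic u, L1 u, Zd_periodic w & L1 w].
Proof. by move=> [[pu /Lfun1_integrable iu] [pw /Lfun1_integrable iw] _]. Qed.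

Lemma is_wpartialP i u w : Zd_periodic u -> L1 u -> Zd_periodic w -> L1 w ->
  (forall phi, test_function phi ->
    \int[mu]_x (u x * 'D_(basis_vec i) phi x) = - \int[mu]_x (w x * phi x)) ->
  is_wpartial i u w.
Proof. by move=> pu iu pw iw H; split => //; split => //; exact/Lfun1_integrable. Qed.

(** The derivative falls on [phi] alone, so the integrand is dominated by [M |u|], where [M] bounds
    the derivative of [phi]. *)
Lemma is_derive_Rint_translate u (i : 'I_d) phi (a : R) : L1 u -> test_function phi ->
  is_derive a 1 (fun h : R => \int[mu]_x (u x * phi (x + h *: basis_vec i)))
    (\int[mu]_x (u x * 'D_(basis_vec i) phi (x + a *: basis_vec i))).
Proof.
move=> iu tp; have tdp := test_derive i tp.
have [M M0 pM] := test_bounded tdp.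
pose F (h : R) x := u x * phi (x + h *: basis_vec i).
have dF (h : R) x : is_derive h 1 (F ^~ x) (u x * 'D_(basis_vec i) phi (x + h *: basis_vec i)).
  have H : is_derive h 1 (fun h : R => phi (x + h *: basis_vec i))
      ('D_(basis_vec i) phi (x + h *: basis_vec i)).
    by apply/is_derive_line/derivableP; exact: test_derivable.
  exact: (is_deriveZ (u x)).
have aI : `]a - 1, a + 1[%classic a by rewrite /= in_itv/=; lra.
have iF h : `]a - 1, a + 1[%classic h -> L1 (F h).
  by move=> _; apply: L1_mul_test => //; exact: test_translate.
have iG : L1 (fun x => M * `|u x|) by exact/L1Z/L1_norm.
have E h x : partial1of2 F h x = u x * 'D_(basis_vec i) phi (x + h *: basis_vec i).
  by rewrite partial1of2E; have [_] := dF h x.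
have HG h y : `]a - 1, a + 1[%classic h -> setT y -> `|partial1of2 F h y| <= M * `|u y|.
  by move=> _ _; rewrite E normrM mulrC ler_wpM2r.
have dF' h y : `]a - 1, a + 1[%classic h -> setT y -> derivable (F ^~ y) h 1.
  by move=> _ _; have [] := dF h y.
have G0 y : 0 <= M * `|u y| by rewrite mulr_ge0// ltW.
split.
  exact: (derivable_under_integral measurableT aI iF dF' G0 iG HG).
rewrite -derive1E (differentiation_under_integral measurableT aI iF dF' G0 iG HG).
by apply: eq_Rintegral => x _; rewrite -E.
Qed.

(* Mean value theorem for the smooth function [h |-> \int u phi(. + h e_i)],
   whose derivative is computed by the definition of the weak derivative. *)
Lemma is_wpartial_MVT i u w phi (t : R) : is_wpartial i u w -> test_function phi ->
  0 < t -> exists2 r, 0 < r < t &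
  \int[mu]_x ((u (x + t *: basis_vec i) - u x) * phi x) =
  t * \int[mu]_x (w (x + r *: basis_vec i) * phi x).
Proof.
move=> H tp t0; have [pu iu pw iw] := is_wpartial_L1 H.
pose G (h : R) := \int[mu]_x (u x * phi (x + h *: basis_vec i)).
have dG (h : R) : is_derive h 1 G (- \int[mu]_x (w x * phi (x + h *: basis_vec i))).
  have H' := is_derive_Rint_translate i h iu tp.
  have [_ _ /(_ _ (test_translate (h *: basis_vec i) tp)) <-] := H.
  apply: (is_derive_eq H').
  by apply: eq_Rintegral => x _; rewrite derive_translate.
(* Shifting [phi] by [h] amounts to shifting [u] by [- h]; a forward step of [u] therefore lives on
   [[- t, 0]], and the intermediate point changes sign at the end. *)
have cG : {within `[- t, 0], continuous G}.
  by apply: derivable_within_continuous => y _; have [] := dG y.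
have nt0 : - t < 0 by rewrite oppr_lt0.
have [r] := MVT nt0 (fun h _ => dG h) cG.
rewrite in_itv/= => /andP[tr r0] E.
have shift v h : Zd_periodic v -> L1 v ->
    \int[mu]_x (v x * phi (x + h *: basis_vec i)) =
    \int[mu]_x (v (x - h *: basis_vec i) * phi x).
  move=> pv iv; rewrite -(@Rint_torus_translate _ _ i h (fun x => v (x - h *: basis_vec i) * phi x)).
  - by apply: eq_Rintegral => x _; rewrite addrK.
  - apply: measurable_funM; last exact: test_measurable.
    apply: (measurableT_comp (L1_measurable iv)).
    exact: (measurable_translate (- (h *: basis_vec i))).
  - by move=> k x; rewrite addrAC pv (tp.1 k).
exists (- r); first by lra.
have iut := @L1_translate _ _ i t _ pu iu.
have -> : \int[mu]_x ((u (x + t *: basis_vec i) - u x) * phi x) = G (- t) - G 0.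
  under eq_Rintegral do rewrite mulrBl.
  rewrite RintB; [|exact: L1_mul_test..].
  by rewrite /G !shift// scaleNr opprK scale0r; under [X in _ = _ - X]eq_Rintegral do rewrite subr0.
rewrite -opprB E opprK add0r shift// mulNr opprK mulrC; congr (_ * _).
by apply: eq_Rintegral => x _; rewrite scaleNr.
Qed.

Lemma is_wpartial_quotient_cvg i u w (e : R) : is_wpartial i u w -> 0 < e ->
  exists2 r : R, 0 < r & forall t, 0 < t -> t <= r ->
    \int[mu]_x `|(u (x + t *: basis_vec i) - u x) / t - w x| <= e.
Proof.
move=> H e0; have [pu iu pw iw] := is_wpartial_L1 H.
have [r r0 rP] := L1_translate_cvg i pw iw e0.
exists r => // t t0 tr.
have iut := @L1_translate _ _ i t _ pu iu.
have iD : L1 (fun x => (u (x + t *: basis_vec i) - u x) / t).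
  by under eq_fun do rewrite mulrC; apply: L1Z; exact: L1B.
apply: L1_norm_dual; first exact: L1B.
move=> phi tp p1.
(* The point [q] depends on [phi], but [rP] covers all shifts up to [r] at once; the bound is thus
   uniform in [phi], as duality requires. *)
have [q /andP[q0 qt] E] := is_wpartial_MVT H tp t0.
have iwq := @L1_translate _ _ i q _ pw iw.
have -> : \int[mu]_x (((u (x + t *: basis_vec i) - u x) / t - w x) * phi x) =
    \int[mu]_x ((w (x + q *: basis_vec i) - w x) * phi x).
  under eq_Rintegral do rewrite mulrBl.
  rewrite RintB; [|exact: L1_mul_test..].
  under [RHS]eq_Rintegral do rewrite mulrBl.
  rewrite RintB; [|exact: L1_mul_test..].
  congr (_ - _); under eq_Rintegral do rewrite mulrAC mulrC.
  rewrite RintZ; last by apply: L1_mul_test => //; exact: L1B.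
  by rewrite E mulKf// gt_eqF.
have iwd := L1B iwq iw.
apply: le_trans (ler_norm _) _; apply: le_trans (le_norm_Rint (L1_mul_test iwd tp)) _.
apply: le_trans (rP q _); last by rewrite gtr0_norm// (le_trans (ltW qt)).
apply: le_Rint; [exact/L1_norm/L1_mul_test|exact: L1_norm|].
by move=> x; rewrite normrM ler_piMr.
Qed.

Lemma norm_Rint_mul_le v f M : L1 v -> measurable_fun setT f ->
  (forall x, `|f x| <= M) -> `|\int[mu]_x (v x * f x)| <= M * \int[mu]_x `|v x|.
Proof.
move=> iv mf fM; have ivf := L1_mul_bounded iv mf fM.
apply: le_trans (le_norm_Rint ivf) _; rewrite -RintZ; last exact: L1_norm.
apply: le_Rint; [exact: L1_norm|exact/L1Z/L1_norm|].
by move=> x; rewrite normrM mulrC ler_wpM2r.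
Qed.

(* The difference quotient of [u] converges to [w] in [L^1]; that of [f] is
   handled by duality: it is tested against a test function close to [u], where
   the mean value theorem applies, and the translation modulus of [u] controls
   the error, so no regularity of [df] beyond boundedness is needed. *)
Lemma is_wpartial_by_parts i u w f df M :
  is_wpartial i u w -> is_wpartial i f df ->
  (forall x, `|f x| <= M) -> (forall x, `|df x| <= M) ->
  \int[mu]_x (w x * f x) = - \int[mu]_x (u x * df x).
Proof.
move=> Hu Hf fM dfM.
have [pu iu pw iw] := is_wpartial_L1 Hu; have [pf if_ pdf idf] := is_wpartial_L1 Hf.
wlog M0 : M fM dfM / 0 < M.
  move=> hw; apply: (hw (`|M| + 1)); last by rewrite ltr_wpDl.
    by move=> x; rewrite (le_trans (fM x))// ler_wpDr// ler_norm.
  by move=> x; rewrite (le_trans (dfM x))// ler_wpDr// ler_norm.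
have mf := L1_measurable if_; have mdf := L1_measurable idf.
apply/eqP; rewrite -addr_eq0 -normr_eq0 eq_le normr_ge0 andbT.
apply/ler_addgt0Pr => e e0; rewrite add0r.
(* Four errors of at most [M c] will be incurred, namely [B1] to [B4]. *)
pose c := e / (4 * M).
have c0 : 0 < c by rewrite divr_gt0// mulr_gt0.
have eE : e = M * c + M * c + M * c + M * c.
  by rewrite /c; field; rewrite gt_eqF.
have [r1 r10 r1P] := is_wpartial_quotient_cvg Hu c0.
have [r2 r20 r2P] := L1_translate_cvg i pu iu c0.
pose t := Num.min 1 (Num.min r1 r2).
have t0 : 0 < t by rewrite !lt_min ltr01 r10 r20.
have t1 : t <= 1 by rewrite ge_min lexx.
have tr1 : t <= r1 by rewrite !ge_min lexx orbT.
have tr2 : t <= r2 by rewrite !ge_min lexx !orbT.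
(* The accuracy [c t / 2] is chosen after [t], because the quotient [q] of [f] is bounded only by
   [2 M / t]. *)
have [phi tp pe] := L1_test_dense iu (mulr_gt0 c0 (divr_gt0 t0 (ltr0Sn R 1))).
have tpt := test_translate (t *: basis_vec i) tp.
have ip := test_L1 tp; have ipt := test_L1 tpt.
have [r /andP[r0 rt] rE] := is_wpartial_MVT Hf tpt t0.
pose q x := (f (x + t *: basis_vec i) - f x) / t.
have iut := @L1_translate _ _ i t _ pu iu.
have ift := @L1_translate _ _ i t _ pf if_.
have idfr := @L1_translate _ _ i r _ pdf idf.
have mft := L1_measurable ift; have mdfr := L1_measurable idfr.
have mq : measurable_fun setT q.
  by apply: measurable_funM => //; exact: measurable_funB.
have qM x : `|q x| <= 2 * M / t.
  rewrite normrM normfV (gtr0_norm t0) ler_wpM2r ?invr_ge0 ?(ltW t0)//.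
  by rewrite (le_trans (ler_normB _ _))// mulr2n mulrDl !mul1r lerD.
have iDu : L1 (fun x => (u (x + t *: basis_vec i) - u x) / t).
  by under eq_fun do rewrite mulrC; apply: L1Z; exact: L1B.
have iuf := L1_mul_bounded iu mf fM.
have iutf := L1_mul_bounded iut mf fM.
have iutft := L1_mul_bounded iut mft (fun x => fM (x + t *: basis_vec i)).
(* Summation by parts: the integral of [u f] is unchanged when both factors are shifted by [t]. *)
have E1 : \int[mu]_x ((u (x + t *: basis_vec i) - u x) / t * f x) =
    - \int[mu]_x (u (x + t *: basis_vec i) * q x).
  transitivity (t^-1 * (\int[mu]_x (u (x + t *: basis_vec i) * f x) -
      \int[mu]_x (u x * f x))).
    rewrite -RintB// -RintZ; last exact: L1B.
    by apply: eq_Rintegral => x _; ring.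
  rewrite -[X in _ * (_ - X)](@Rint_torus_translate _ _ i t (fun x => u x * f x)).
  - rewrite -RintB// -RintZ; last exact: L1B.
    rewrite -mulN1r -RintZ; last exact: L1_mul_bounded qM.
    by apply: eq_Rintegral => x _; rewrite /q; ring.
  - exact: L1_measurable iuf.
  - by move=> k x; rewrite pu pf.
have E2 : \int[mu]_x (phi (x + t *: basis_vec i) * q x) =
    \int[mu]_x (phi (x + t *: basis_vec i) * df (x + r *: basis_vec i)).
  transitivity (t^-1 * \int[mu]_x ((f (x + t *: basis_vec i) - f x) *
      phi (x + t *: basis_vec i))).
    rewrite -RintZ; last by apply: L1_mul_test => //; exact: L1B.
    by apply: eq_Rintegral => x _; rewrite /q; ring.
  by rewrite rE mulKf ?gt_eqF//; apply: eq_Rintegral => x _; rewrite mulrC.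
(* The unknown shift [r] is taken off [df] and put on [u], whose translations are under control; the
   remaining shift [t - r] lies in []0, t[]. *)
have E3 : \int[mu]_x (u (x + t *: basis_vec i) * df (x + r *: basis_vec i)) =
    \int[mu]_x (u (x + (t - r) *: basis_vec i) * df x).
  have iutr := @L1_translate _ _ i (t - r) _ pu iu.
  rewrite -[RHS](@Rint_torus_translate _ _ i r (fun x => u (x + (t - r) *: basis_vec i) * df x)).
  - apply: eq_Rintegral => x _; congr (u _ * _).
    by rewrite -addrA -scalerDl; congr (_ + _ *: _); ring.
  - exact/L1_measurable/(L1_mul_bounded iutr mdf dfM).
  - by move=> k x; rewrite addrAC pu pdf.
have iutr := @L1_translate _ _ i (t - r) _ pu iu.
have dfrM x := dfM (x + r *: basis_vec i).
(* With subscripts for shifts, the integrands pass from [w f] to [- u_t q], then to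
   [- phi_t q = - phi_t df_r], then to [- u_t df_r = - u_{t-r} df], and finally to [- u df], where
   equality is that of the integrals. *)
have B1 : `|\int[mu]_x (w x * f x) -
    \int[mu]_x ((u (x + t *: basis_vec i) - u x) / t * f x)| <= M * c.
  rewrite -RintB; [|exact: L1_mul_bounded fM..].
  under eq_Rintegral do rewrite -mulrBl.
  apply: le_trans (norm_Rint_mul_le (L1B iw iDu) mf fM) _.
  rewrite ler_wpM2l ?(ltW M0)//; under eq_Rintegral do rewrite distrC.
  exact: r1P.
have phiu : \int[mu]_x `|phi (x + t *: basis_vec i) - u (x + t *: basis_vec i)| =
    \int[mu]_x `|phi x - u x|.
  rewrite (@Rint_torus_translate _ _ i t (fun x => `|phi x - u x|))//.
    by apply: (@L1_measurable _ _ _ mu); exact/L1_norm/L1B.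
  by move=> k x; rewrite (tp.1 k) pu.
have B2 : `|\int[mu]_x (phi (x + t *: basis_vec i) * q x) -
    \int[mu]_x (u (x + t *: basis_vec i) * q x)| <= M * c.
  rewrite -RintB; [|exact: L1_mul_bounded qM..].
  under eq_Rintegral do rewrite -mulrBl.
  apply: le_trans (norm_Rint_mul_le (L1B ipt iut) mq qM) _.
  rewrite phiu; apply: le_trans (ler_wpM2l _ pe) _.
    by rewrite divr_ge0 ?mulr_ge0 ?ltW.
  by rewrite le_eqVlt; apply/orP; left; apply/eqP; field; rewrite gt_eqF.
have B3 : `|\int[mu]_x (phi (x + t *: basis_vec i) * df (x + r *: basis_vec i)) -
    \int[mu]_x (u (x + t *: basis_vec i) * df (x + r *: basis_vec i))| <= M * c.
  rewrite -RintB; [|exact: L1_mul_bounded dfrM..].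
  under eq_Rintegral do rewrite -mulrBl.
  apply: le_trans (norm_Rint_mul_le (L1B ipt iut) mdfr dfrM) _.
  rewrite phiu ler_wpM2l ?(ltW M0)// (le_trans pe)// ger_pMr//; lra.
have B4 : `|\int[mu]_x (u (x + (t - r) *: basis_vec i) * df x) -
    \int[mu]_x (u x * df x)| <= M * c.
  rewrite -RintB; [|exact: L1_mul_bounded dfM..].
  under eq_Rintegral do rewrite -mulrBl.
  apply: le_trans (norm_Rint_mul_le (L1B iutr iu) mdf dfM) _.
  rewrite ler_wpM2l ?(ltW M0)//; apply: r2P; rewrite gtr0_norm; lra.
rewrite E1 in B1; rewrite E2 in B2; rewrite E3 in B3.
move: B1 B2 B3 B4; rewrite !ler_norml eE; lra.
Qed.

End weak_derivatives.

(** As soon as [tau n * a_ n < 1], the quotient lies between [a_ n] and [a_ n / (1 - tau n * a_ n)],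
    by [1 + y <= exp y] at [y] and at [- y]. *)
Lemma expR_quotient_cvg (R : realType) (a_ tau : nat -> R) (a : R) :
  (forall n, 0 < tau n) -> tau @ \oo --> 0 -> a_ @ \oo --> a ->
  (expR (tau n * a_ n) - 1) / tau n @[n --> \oo] --> a.
Proof.
move=> tau0 ctau ca.
have cta : tau n * a_ n @[n --> \oo] --> 0.
  by rewrite -(mul0r a); exact: cvgM.
have c1 : 1 - tau n * a_ n @[n --> \oo] --> (1 : R).
  by rewrite -[X in _ --> X]subr0; apply: cvgB => //; exact: cvg_cst.
have cu : a_ n / (1 - tau n * a_ n) @[n --> \oo] --> a.
  rewrite -[X in _ --> X]divr1; apply: cvgM => //; apply: cvgV => //.
apply: squeeze_cvgr ca cu.
have /cvgrPdist_lt/(_ _ ltr01) := cta.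
apply: filterS => n; rewrite sub0r normrN => tan.
have t0 := tau0 n.
have d0 : 0 < 1 - tau n * a_ n by rewrite subr_gt0 (le_lt_trans (ler_norm _)).
apply/andP; split.
  by rewrite ler_pdivlMr// mulrC lerBrDl expR_ge1Dx.
rewrite ler_pdivrMr//.
have : expR (tau n * a_ n) <= (1 - tau n * a_ n)^-1.
  rewrite -[leLHS]invrK -expRN lef_pV2 ?posrE ?expR_gt0//.
  exact: expR_ge1Dx.
move=> H; rewrite -lerBrDr opprK in H *; apply: le_trans H _.
rewrite le_eqVlt; apply/orP; left; apply/eqP; field; rewrite gt_eqF//.
Qed.

(** * Chain rule for the logarithm, and passage to almost everywhere bounds *)

Section chain_rule.
Context {R : realType} {d : nat}.
Local Notation mu := (@torus_measure R d).
Local Notation L1 u := (mu.-integrable setT (EFin \o u)).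
Implicit Types u w v phi f : 'rV[R]_d -> R.

Lemma ae_translate (i : 'I_d) (t : R) (A : set 'rV[R]_d) : measurable A ->
  Zd_periodic A -> {ae mu, forall x, A x} ->
  {ae mu, forall x, A (x + t *: basis_vec i)}.
Proof.
move=> mA pA aeA.
have mC : measurable (~` A) by exact: measurableC.
have mtr : measurable ((fun x : 'rV[R]_d => x + t *: basis_vec i) @^-1` (~` A)).
  by rewrite -[X in measurable X]setTI; apply: measurable_translate.
exists ((fun x : 'rV[R]_d => x + t *: basis_vec i) @^-1` (~` A)); split => //.
have E B : measurable B -> (\int[mu]_x (\1_B x)%:E = mu B)%E.
  by move=> mB; rewrite integral_indic// setIT.
have C0 : mu (~` A) = 0%E by apply/negligibleP.
rewrite -C0 -(E _ mtr) -(E _ mC).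
rewrite -[RHS](@integral_torus_translate R d i t (fun x => (\1_(~` A) x)%:E)) //.
  exact/measurable_EFinP/measurable_indic.
move=> k x; rewrite !indicE !in_setC.
suff -> : (x + map_mx intr k \in A) = (x \in A) by [].
by apply/idP/idP => /set_mem h; apply/mem_set; move: h; rewrite pA.
Qed.

Lemma ae_wpartial_chain i f u df : {ae mu, forall x, 0 < f x} ->
  is_wpartial i (fun x => ln (f x)) u -> is_wpartial i f df ->
  {ae mu, forall x, df x = f x * u x}.
Proof.
move=> f0 Hu Hf.
have [plf ilf pu iu] := is_wpartial_L1 Hu; have [pf if_ pdf idf] := is_wpartial_L1 Hf.
pose tau (n : nat) : R := n.+1%:R^-1.
have tau0 n : 0 < tau n by rewrite invr_gt0.
pose D g n x := (g (x + tau n *: basis_vec i) - g x) / tau n.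
have iD g n : Zd_periodic g -> L1 g -> L1 (D g n).
  move=> pg ig; under [D g n]funext => x do rewrite /D mulrC.
  by apply: L1Z; apply: L1B => //; exact: L1_translate.
have cD g w : is_wpartial i g w -> \int[mu]_x `|D g n x - w x| @[n --> \oo] --> 0.
  move=> H; apply/cvgrPdist_le => e e0.
  have [r r0 rP] := is_wpartial_quotient_cvg H e0.
  have := near_infty_natSinv_lt (PosNum r0); apply: filterS => n nr.
  rewrite sub0r normrN ger0_norm ?Rint_norm_ge0//; apply: rP => //.
  exact: ltW.
(* Adding the two errors yields one subsequence along which both difference quotients converge. *)
pose v n x := `|D f n x - df x| + `|D (fun x => ln (f x)) n x - u x|.
have iv n : L1 (v n).
  by apply: L1D; apply/L1_norm/L1B => //; exact: iD.
have cv : \int[mu]_x `|v n x - cst 0 x| @[n --> \oo] --> 0.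
  rewrite (_ : (fun n => _) = (fun n => \int[mu]_x `|D f n x - df x| +
      \int[mu]_x `|D (fun x => ln (f x)) n x - u x|)).
    by rewrite -[X in _ --> X]addr0; apply: cvgD; exact: cD.
  apply/funext => n; rewrite -RintD; [|by apply/L1_norm/L1B => //; exact: iD..].
  by apply: eq_Rintegral => x _; rewrite subr0 ger0_norm ?addr_ge0.
have i0 : L1 (cst 0 : 'rV[R]_d -> R) by exact: (test_L1 (test_cst 0)).
have [s [sn aes]] := cvg_L1_ae_subseq iv i0 cv.
(* [exp] undoes [ln] only at positive values, so positivity is needed at all shifted points outside
   one null set; there are countably many shifts. *)
have fpos : {ae mu, forall x n, 0 < f (x + tau (s n) *: basis_vec i)}.
  apply: ae_foralln => n.
  apply: (@ae_translate i (tau (s n)) [set x | 0 < f x]) => //.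
    rewrite -[X in measurable X]setTI (_ : [set x | _] = f @^-1` `]0, +oo[%classic).
      by apply: (L1_measurable if_) => //; exact: measurable_itv.
    by apply/seteqP; split => x /=; rewrite in_itv/= andbT.
  by move=> k x; apply/propext; rewrite /= pf.
have ctau : tau (s n) @[n --> \oo] --> 0.
  apply/cvgrPdist_le => e e0.
  have := near_infty_natSinv_lt (PosNum e0); apply: filterS => n /= ne.
  rewrite sub0r normrN gtr0_norm//; apply: le_trans (ltW ne).
  by rewrite lef_pV2 ?posrE// ler_nat ltnS.
move: aes fpos f0; apply: filterS3 => x cx fx f0x.
have cDf : D f (s n) x @[n --> \oo] --> df x.
  apply/cvgrPdist_le => e e0; have /cvgrPdist_le/(_ _ e0) := cx.
  apply: filterS => n; rewrite sub0r normrN distrC; apply: le_trans.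
  by rewrite [leRHS]ger0_norm ?addr_ge0// lerDl.
have cDu : D (fun x => ln (f x)) (s n) x @[n --> \oo] --> u x.
  apply/cvgrPdist_le => e e0; have /cvgrPdist_le/(_ _ e0) := cx.
  apply: filterS => n; rewrite sub0r normrN distrC; apply: le_trans.
  by rewrite [leRHS]ger0_norm ?addr_ge0// lerDr.
have cE : f x * ((expR (tau (s n) * D (fun x => ln (f x)) (s n) x) - 1) / tau (s n))
    @[n --> \oo] --> f x * u x.
  by apply: cvgM; [exact: cvg_cst|exact: expR_quotient_cvg].
apply: (cvg_unique _ cDf) => //.
rewrite (_ : (fun n => D f (s n) x) = (fun n => f x *
    ((expR (tau (s n) * D (fun x => ln (f x)) (s n) x) - 1) / tau (s n))))//.
apply/funext => n.
rewrite /D (mulrCA (tau _)) mulfV ?gt_eqF// mulr1 expRD expRN !lnK ?posrE//.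
by rewrite mulrA mulrBr mulr1 mulrCA mulfV ?gt_eqF// mulr1.
Qed.

(** Periodicity is required again of [u'] and [w'] because it is a condition at every point, which
    almost everywhere equality does not transfer. *)
Lemma is_wpartial_ae i u w u' w' : is_wpartial i u w ->
  Zd_periodic u' -> Zd_periodic w' -> measurable_fun setT u' -> measurable_fun setT w' ->
  {ae mu, forall x, u x = u' x} -> {ae mu, forall x, w x = w' x} ->
  is_wpartial i u' w'.
Proof.
move=> H pu' pw' mu' mw' uu' ww'; have [pu iu pw iw] := is_wpartial_L1 H.
have iu' := L1_ae mu' iu uu'; have iw' := L1_ae mw' iw ww'.
apply: is_wpartialP => // phi tp.
have [_ _ /(_ _ tp) E] := H.
have tdp := test_derive i tp.
transitivity (\int[mu]_x (u x * 'D_(basis_vec i) phi x)).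
  apply: ae_eq_Rintegral; [exact/L1_measurable/(L1_mul_test _ tdp)..|].
  by apply: filterS uu' => x ->.
rewrite E; congr (- _).
apply: ae_eq_Rintegral; [exact/L1_measurable/(L1_mul_test _ tp)..|].
by apply: filterS ww' => x ->.
Qed.

(** Clamping turns an almost everywhere bound into a bound at every point while changing the
    function only on a null set. *)
Definition truncate (M x : R) := Num.max (- M) (Num.min M x).

Lemma truncate_norm_le M x : 0 <= M -> `|truncate M x| <= M.
Proof.
move=> M0; rewrite ler_norml /truncate le_max lexx /= ge_max ge_min lexx andbT.
by lra.
Qed.

Lemma truncate_id M x : `|x| <= M -> truncate M x = x.
Proof. by rewrite ler_norml /truncate => /andP[? ?]; rewrite min_r// max_r. Qed.

Lemma measurable_truncate M u : measurable_fun setT u ->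
  measurable_fun setT (fun x => truncate M (u x)).
Proof.
by move=> mu_; apply: measurable_maxr => //; exact: measurable_minr.
Qed.

Lemma is_wpartial_by_parts_ae i u w f df M :
  is_wpartial i u w -> is_wpartial i f df ->
  {ae mu, forall x, `|f x| <= M} -> {ae mu, forall x, `|df x| <= M} ->
  \int[mu]_x (w x * f x) = - \int[mu]_x (u x * df x).
Proof.
move=> Hu Hf fM dfM; have [pf if_ pdf idf] := is_wpartial_L1 Hf.
have [pu iu pw iw] := is_wpartial_L1 Hu.
have mf := L1_measurable if_; have mdf := L1_measurable idf.
have mw := L1_measurable iw; have mu_ := L1_measurable iu.
have M0 : 0 <= `|M| by [].
have fM' : {ae mu, forall x, f x = truncate `|M| (f x)}.
  by apply: filterS fM => x fx; rewrite truncate_id// (le_trans fx)// ler_norm.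
have dfM' : {ae mu, forall x, df x = truncate `|M| (df x)}.
  by apply: filterS dfM => x fx; rewrite truncate_id// (le_trans fx)// ler_norm.
have mtf := measurable_truncate `|M| mf; have mtdf := measurable_truncate `|M| mdf.
have Hf' : is_wpartial i (fun x => truncate `|M| (f x)) (fun x => truncate `|M| (df x)).
  apply: (is_wpartial_ae Hf) => //.
  - by move=> k x; rewrite pf.
  - by move=> k x; rewrite pdf.
transitivity (\int[mu]_x (w x * truncate `|M| (f x))).
  apply: ae_eq_Rintegral; [exact: measurable_funM..|].
  by apply: filterS fM' => x <-.
rewrite (is_wpartial_by_parts Hu Hf' (fun x => truncate_norm_le _ M0)
  (fun x => truncate_norm_le _ M0)).
congr (- _); apply: ae_eq_Rintegral; [exact: measurable_funM..|].
by apply: filterS dfM' => x <-.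
Qed.

Lemma Lp_oo_ae_bounded u : Lp +oo%E u ->
  exists M : R, {ae mu, forall x, `|u x| <= M}.
Proof.
move=> [_]; rewrite inE => /andP[_]; rewrite inE/= /finite_norm unlock /Lnorm.
(* [Lnorm] at [+oo] is the essential supremum only when the total mass is positive; here it is 1. *)
rewrite [X in (0 < X)%E](_ : _ = 1%E) ?lte01; last exact: probability_setT.
move=> H.
exact: (ess_supr_bounded (f := fun x => `|u x|)).
Qed.

End chain_rule.

(** * Lipschitz functions *)

Section lipschitz_weak_derivative.
Context {R : realType} {d : nat}.
Local Notation mu := (@torus_measure R d).
Local Notation L1 u := (mu.-integrable setT (EFin \o u)).
Implicit Types u w v phi f : 'rV[R]_d -> R.

Definition periodic_bounded (L : R) v :=
  [/\ measurable_fun setT v, Zd_periodic v & forall x, `|v x| <= L].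

Lemma periodic_bounded_L1 L v : periodic_bounded L v -> L1 v.
Proof. by move=> [mv _ vL]; exact: L1_bounded vL. Qed.

Lemma periodic_bounded_sqr L v : periodic_bounded L v -> L1 (fun x => v x ^+ 2).
Proof.
move=> [mv pv vL]; apply: (@L1_bounded _ _ _ _ _ (L ^+ 2)).
  exact: measurable_funX.
by move=> x; rewrite normrX lerXn2r// nnegrE// (le_trans _ (vL x)).
Qed.

Lemma periodic_bounded_mid L v w : periodic_bounded L v -> periodic_bounded L w ->
  periodic_bounded L (fun x => (v x + w x) / 2).
Proof.
move=> [mv pv vL] [mw pw wL]; split.
- by apply: measurable_funM => //; exact: measurable_funD.
- by move=> k x; rewrite pv pw.
- move=> x; rewrite normrM normfV (gtr0_norm (ltr0Sn R 1)) ler_pdivrMr//.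
  by rewrite (le_trans (ler_normD _ _))// mulr2n mulrDr mulr1 lerD.
Qed.

(** The parallelogram identity bounds the integral of [(w - v)^2] by
    [4 (J + e^2 / 8) - 4 (J - e^2 / 8) = e^2], whence the 8. *)
Lemma parallelogram_L1_le L v w (J e : R) : 0 < e ->
  periodic_bounded L v -> periodic_bounded L w ->
  \int[mu]_x (v x ^+ 2) <= J + e ^+ 2 / 8 -> \int[mu]_x (w x ^+ 2) <= J + e ^+ 2 / 8 ->
  J - e ^+ 2 / 8 <= \int[mu]_x (((v x + w x) / 2) ^+ 2) ->
  \int[mu]_x `|w x - v x| <= e.
Proof.
move=> e0 bv bw vJ wJ mJ.
have iv := periodic_bounded_L1 bv; have iw := periodic_bounded_L1 bw.
have iv2 := periodic_bounded_sqr bv; have iw2 := periodic_bounded_sqr bw.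
have im2 := periodic_bounded_sqr (periodic_bounded_mid bv bw).
have E : \int[mu]_x (2 * (v x ^+ 2 + w x ^+ 2) - 4 * ((v x + w x) / 2) ^+ 2) =
    2 * (\int[mu]_x (v x ^+ 2) + \int[mu]_x (w x ^+ 2)) -
    4 * \int[mu]_x (((v x + w x) / 2) ^+ 2).
  rewrite RintB; [|by apply: L1Z; exact: L1D|exact: L1Z].
  by rewrite !RintZ//; [rewrite RintD|exact: L1D].
have iE : L1 (fun x => 2 * (v x ^+ 2 + w x ^+ 2) - 4 * ((v x + w x) / 2) ^+ 2).
  by apply: L1B; apply: L1Z => //; exact: L1D.
have ic : L1 (cst e : 'rV[R]_d -> R) by exact: (test_L1 (test_cst e)).
(* [2 |a| <= a ^ 2 / e + e], with [a = w - v] *)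
apply: (@le_trans _ _ (\int[mu]_x (2^-1 * (e^-1 * (2 * (v x ^+ 2 + w x ^+ 2) -
    4 * ((v x + w x) / 2) ^+ 2) + e)))).
  apply: le_Rint; [exact/L1_norm/L1B|by apply: L1Z; apply: L1D => //; exact: L1Z|].
  move=> x; set a := w x - v x.
  have -> : 2 * (v x ^+ 2 + w x ^+ 2) - 4 * ((v x + w x) / 2) ^+ 2 = `|a| ^+ 2.
    by rewrite real_normK ?num_real// /a; field.
  have : 0 <= (`|a| - e) ^+ 2 / e by rewrite divr_ge0 ?sqr_ge0// ltW.
  have -> : (`|a| - e) ^+ 2 / e = e^-1 * `|a| ^+ 2 + e - 2 * `|a|.
    by field; rewrite gt_eqF.
  by lra.
rewrite RintZ; last by apply: L1D => //; exact: L1Z.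
rewrite RintD//; last exact: L1Z.
rewrite RintZ// Rint_cst E.
set V := \int[mu]_x (v x ^+ 2) in vJ *; set W := \int[mu]_x (w x ^+ 2) in wJ *.
set Q := \int[mu]_x _ in mJ *.
have : 2 * (V + W) - 4 * Q <= e ^+ 2 by lra.
move=> /(ler_wpM2l (_ : 0 <= e^-1)) => /(_ (ltW _)).
rewrite invr_gt0 => /(_ e0).
have -> : e^-1 * e ^+ 2 = e by field; rewrite gt_eqF.
by lra.
Qed.

(* The [n]-th set of functions consists of those whose error against every test
   function is at most that of the tail [n, n + 1, ...] of [D_]; it is stable
   under midpoints, and near-minimizers of the [L^2] norm in these shrinking
   sets form, by the parallelogram identity, a Cauchy sequence. *)
Lemma bounded_weak_limit (L : R) (D_ : nat -> 'rV[R]_d -> R)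
    (B : ('rV[R]_d -> R) -> R) :
  (forall n, periodic_bounded L (D_ n)) ->
  (forall phi, test_function phi ->
    \int[mu]_x (D_ n x * phi x) @[n --> \oo] --> B phi) ->
  exists2 w, periodic_bounded L w &
    forall phi, test_function phi -> \int[mu]_x (w x * phi x) = B phi.
Proof.
move=> bD cD.
have L0 : 0 <= L by have [_ _ /(_ 0)] := bD 0; apply: le_trans.
pose C n v := periodic_bounded L v /\ forall phi c, test_function phi ->
  (forall m, (n <= m)%N -> `|\int[mu]_x (D_ m x * phi x) - B phi| <= c) ->
  `|\int[mu]_x (v x * phi x) - B phi| <= c.
have CD n : C n (D_ n) by split => // phi c tp; apply.
have CW m n v : (m <= n)%N -> C n v -> C m v.
  move=> mn [bv Hv]; split => // phi c tp H; apply: Hv => // k nk; apply: H.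
  exact: leq_trans nk.
have Cmid n v w : C n v -> C n w -> C n (fun x => (v x + w x) / 2).
  move=> [bv Hv] [bw Hw]; split; first exact: periodic_bounded_mid.
  move=> phi c tp H; have := Hv _ _ tp H; have := Hw _ _ tp H.
  have iv := L1_mul_test (periodic_bounded_L1 bv) tp.
  have iw := L1_mul_test (periodic_bounded_L1 bw) tp.
  have -> : \int[mu]_x ((v x + w x) / 2 * phi x) =
      2^-1 * (\int[mu]_x (v x * phi x) + \int[mu]_x (w x * phi x)).
    rewrite -RintD// -RintZ; last exact: L1D.
    by apply: eq_Rintegral => x _; field.
  by rewrite !ler_norml; lra.
pose N2 v := \int[mu]_x (v x ^+ 2).
pose I n := inf [set N2 v | v in C n].
have N2ge0 v : 0 <= N2 v by apply: Rintegral_ge0 => x _; exact: sqr_ge0.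
have hinf n : has_inf [set N2 v | v in C n].
  by split; [exists (N2 (D_ n)); exists (D_ n)|exists 0 => _ [v _ <-]].
have Ile n v : C n v -> I n <= N2 v.
  by move=> Cv; apply: ge_inf; [have [] := hinf n|exists v].
have N2le v : periodic_bounded L v -> N2 v <= L ^+ 2.
  move=> bv; rewrite -[leRHS](Rint_cst mu); apply: le_Rint.
  - exact: periodic_bounded_sqr bv.
  - exact: (test_L1 (test_cst (L ^+ 2))).
  - move=> x; have [_ _ /(_ x) vL] := bv.
    by rewrite -(real_normK (num_real (v x))) lerXn2r// nnegrE.
(* The constraint sets shrink with [n], so the infima increase; [L ^+ 2] bounds them, and their
   limit [J] is the common target of the near-minimizers. *)
have Ind : nondecreasing_seq I.
  move=> m n mn; apply: lb_le_inf; first by have [] := hinf n.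
  by move=> _ [v Cv <-]; apply: Ile; exact: CW Cv.
have Iub n : I n <= L ^+ 2 by apply: le_trans (Ile _ _ (CD n)) (N2le _ (bD n)).
have cI : I @ \oo --> sup (range I).
  by apply: nondecreasing_cvgn => //; exists (L ^+ 2) => _ [n _ <-].
set J := sup (range I) in cI.
have IJ n : I n <= J.
  by apply: ub_le_sup; [exists (L ^+ 2) => _ [m _ <-]|exists n].
(* These are the bounds asked by [ae_cvg_series]; the tolerance [e k ^+ 2 / 8] on the squared norm
   is that of the parallelogram estimate. *)
pose e (k : nat) : R := 1 / (2 ^ k.+1)%:R.
have e0 k : 0 < e k by rewrite divr_gt0// ltr0n expn_gt0.
have /choice[v_ v_P] : forall k : nat, exists v, exists n, [/\ (k <= n)%N, C n v,
    N2 v <= J + e k ^+ 2 / 8 & forall m, (n <= m)%N -> J - e k ^+ 2 / 8 <= I m].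
  move=> k; have ek : 0 < e k ^+ 2 / 8 by rewrite divr_gt0// exprn_gt0.
  have /cvgrPdist_le/(_ _ ek) [m _ Hm] := cI.
  pose n := maxn k m.
  have [_ [v Cv <-] vn] := inf_adherent ek (hinf n).
  exists v, n; split => //; first exact: leq_maxl.
    by apply: le_trans (ltW vn) _; rewrite lerD2r; exact: IJ.
  move=> p np; have /= := Hm p (leq_trans (leq_maxr _ _) np).
  by rewrite ler_norml; lra.
have eS k : e k.+1 ^+ 2 <= e k ^+ 2.
  have le : e k.+1 <= e k.
    by rewrite /e ler_pM2l// lef_pV2 ?posrE ?ltr0n ?expn_gt0// ler_nat leq_exp2l.
  by rewrite lerXn2r// nnegrE ltW.
have bv k : periodic_bounded L (v_ k) by have [n [_ []]] := v_P k.
have Dv k : \int[mu]_x `|v_ k.+1 x - v_ k x| <= e k.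
  have [n [_ Cn nJ In]] := v_P k; have [n' [_ Cn' n'J In']] := v_P k.+1.
  apply: (parallelogram_L1_le (e0 k) (bv k) (bv k.+1) nJ).
    by apply: le_trans n'J _; have := eS k; lra.
  (* The two functions come from different constraint sets; their midpoint lies in the larger one,
     of index [minn n n'], whose infimum is still close to [J]. *)
  apply: (@le_trans _ _ (I (minn n n'))); last first.
    by apply: Ile; apply: Cmid; [apply: CW Cn; exact: geq_minl|apply: CW Cn'; exact: geq_minr].
  case: (leqP n n') => _; first exact: In.
  by apply: le_trans (In' _ (leqnn _)); have := eS k; lra.
have iv k := periodic_bounded_L1 (bv k).
have aes := ae_cvg_series (fun k => L1B (iv k.+1) (iv k)) Dv.
have aec : {ae mu, forall x, cvgn (fun k => v_ k x)}.
  apply: filterS aes => x cx.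
  have /normed_cvg cs : cvgn [normed series (fun k => v_ k.+1 x - v_ k x)] by [].
  rewrite (_ : (fun k => v_ k x) =
      (fun k => v_ 0 x + series (fun k => v_ k.+1 x - v_ k x) k)).
    by apply: is_cvgD => //; exact: is_cvg_cst.
  apply/funext => k.
  by rewrite /series /= telescope_sumr// addrC subrK.
(* The upper limit exists at every point, so [w] is measurable and periodic everywhere and agrees
   with the limit wherever there is one. *)
pose w x := truncate L (fine (limn_esup (fun k => (v_ k x)%:E))).
have mw : measurable_fun setT w.
  apply: measurable_truncate; apply: measurableT_comp => //.
  apply: measurable_fun_limn_esup => m; apply/measurable_EFinP.
  by have [] := bv m.
have vw : {ae mu, forall x, v_ k x @[k --> \oo] --> w x}.
  apply: filterS aec => x /cvg_ex[l cl].
  have cE : (v_ k x)%:E @[k --> \oo] --> l%:E by apply: cvg_EFin; [exact: nearW|].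
  have lL : `|l| <= L.
    have cnl : (`|v_ k x| : R) @[k --> \oo] --> (`|l| : R) by exact: cvg_norm.
    rewrite -(cvg_lim (@Rhausdorff R) cnl); apply: limr_le; first exact: (cvgP _ cnl).
    by apply: nearW => k; have [] := bv k.
  rewrite /w; have [_ ->] := cvg_limn_einf_sup cE; by rewrite /= truncate_id.
have bw : periodic_bounded L w.
  split => //; last by move=> x; exact: truncate_norm_le.
  move=> k x; rewrite /w; congr (truncate _ (fine (limn_esup _))).
  by apply/funext => n; have [_ -> _] := bv n.
exists w => // phi tp.
have [M M0 pM] := test_bounded tp.
have mphi := test_measurable tp.
have mvp k : measurable_fun setT (fun x => (v_ k x * phi x)%:E).
  by apply/measurable_EFinP/measurable_funM => //; have [] := bv k.
have mwp : measurable_fun setT (fun x => (w x * phi x)%:E).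
  by apply/measurable_EFinP/measurable_funM.
have cvp : {ae mu, forall x, setT x -> (v_ k x * phi x)%:E @[k --> \oo] --> (w x * phi x)%:E}.
  apply: filterS vw => x cx _; apply: cvg_EFin; first exact: nearW.
  by apply: cvgM => //; exact: cvg_cst.
have dom : {ae mu, forall x k, setT x ->
    (`|(v_ k x * phi x)%:E| <= (cst (L * M)%:E : _ -> \bar R) x)%E}.
  by apply: aeW => x k _; rewrite lee_fin normrM ler_pM//; have [] := bv k.
have [iwp _ cint] := dominated_convergence measurableT mvp mwp cvp
  (finite_measure_integrable_cst mu (L * M) measurableT) dom.
have cint' : \int[mu]_x (v_ k x * phi x) @[k --> \oo] --> \int[mu]_x (w x * phi x).
  move: cint; rewrite -(fineK (integrable_fin_num measurableT iwp)) => /fine_cvgP[_].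
  by [].
apply: (cvg_unique _ cint') => //.
apply/cvgrPdist_le => c c0.
have /cvgrPdist_le/(_ _ c0) [m _ Hm] := cD _ tp.
exists m => // k /= mk; rewrite distrC.
(* Since [m <= k <= n], the tail from [n] has error at most [c] against [phi], and membership in
   [C n] passes this bound to [v_ k]. *)
have [n [kn Cn _ _]] := v_P k.
apply: Cn.2 => // p np; rewrite distrC; apply: Hm => /=.
exact: leq_trans mk (leq_trans kn np).
Qed.

Lemma lipschitz_continuous_rV (h : 'rV[R]_d -> R) (M : R) :
  (forall x y, `|h x - h y| <= M * `|x - y|) -> continuous h.
Proof.
move=> hM.
move=> x; apply/(@cvgrPdist_lt _ _ _ (nbhs x)) => e e0; apply/nbhs_ballP.
have M1 : 0 < `|M| + 1 by rewrite ltr_wpDl.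
exists (e / (`|M| + 1)) => /=; first by rewrite divr_gt0.
move=> y; rewrite mx_norm_ball /ball_ /= => xy; apply: le_lt_trans (hM _ _) _.
apply: (@le_lt_trans _ _ ((`|M| + 1) * `|x - y|)).
  by rewrite ler_wpM2r// ler_wpDr// ler_norm.
by rewrite mulrC -ltr_pdivlMr.
Qed.

Lemma lipschitz_bounded (h : 'rV[R]_d -> R) (M : R) : Zd_periodic h ->
  (forall x y, `|h x - h y| <= M * `|x - y|) ->
  exists2 K, 0 < K & forall x, `|h x| <= K.
Proof.
by move=> ph /lipschitz_continuous_rV; exact: periodic_continuous_bounded.
Qed.

Lemma bounded_Lfun2 u K : measurable_fun setT u -> (forall x, `|u x| <= K) ->
  u \in Lfun mu 2%:E.
Proof.
move=> mu_ uK.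
apply: (@Lfun_subset _ _ _ mu 2%:E +oo%E _ _ _ _) => //.
- by rewrite lee_fin ler1n.
- exact: leey.
- exact: fin_num_measure.
- exact: leey.
rewrite inE; apply/andP; split; rewrite inE//= /finite_norm unlock /Lnorm.
case: ifPn => // _; apply: (@le_lt_trans _ _ K%:E); last exact: ltry.
by apply/ess_supP; apply: aeW => x; rewrite /= lee_fin.
Qed.

Lemma normr_basis_vec (i : 'I_d) : `|basis_vec i : 'rV[R]_d| = 1.
Proof.
rewrite /Num.norm /= mx_normrE; apply/eqP; rewrite eq_le; apply/andP; split.
  apply/bigmax_leP; split => //= -[a b] _ /=; rewrite mxE.
  by case: (_ && _); rewrite ?normr1 ?normr0.
apply/bigmax_geP; right; exists (ord0, i) => //=.
by rewrite mxE !eqxx normr1.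
Qed.

(** The difference quotients are bounded by [M] because [basis_vec i] has sup norm 1. Tested against
    [phi], they become backward quotients of [phi], whose limit is known; this provides the
    functional [B] of [bounded_weak_limit]. *)
Lemma lipschitz_is_wpartial (i : 'I_d) (h : 'rV[R]_d -> R) (M : R) : Zd_periodic h ->
  (forall x y, `|h x - h y| <= M * `|x - y|) ->
  exists2 w, periodic_bounded M w & is_wpartial i h w.
Proof.
move=> ph hM.
have ch := lipschitz_continuous_rV hM.
have mh := continuous_rV_measurable ch.
have [Mh Mh0 hb] := periodic_continuous_bounded ph ch.
have ih : L1 h by exact: L1_bounded hb.
pose tau (n : nat) : R := n.+1%:R^-1.
have tau0 n : 0 < tau n by rewrite invr_gt0.
pose D n x := (h (x + tau n *: basis_vec i) - h x) / tau n.
have bD n : periodic_bounded M (D n).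
  split.
  - apply: measurable_funM => //; apply: measurable_funB => //.
    by apply: (measurableT_comp mh); exact: measurable_translate.
  - by move=> k x; rewrite /D addrAC !ph.
  - move=> x; rewrite normrM normfV (gtr0_norm (tau0 n)) ler_pdivrMr//.
    apply: le_trans (hM _ _) _; rewrite addrC addKr normrZ (gtr0_norm (tau0 n)).
    by rewrite normr_basis_vec mulr1.
have cD phi : test_function phi ->
    \int[mu]_x (D n x * phi x) @[n --> \oo] -->
    - \int[mu]_x (h x * 'D_(basis_vec i) phi x).
  move=> tp.
  pose G (a : R) := \int[mu]_x (h x * phi (x + a *: basis_vec i)).
  have [dG GE] := is_derive_Rint_translate i 0 ih tp.
  have cG : (a^-1 *: ((G \o shift 0) (a *: (1 : R)) - G 0)) @[a --> 0^'] -->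
      \int[mu]_x (h x * 'D_(basis_vec i) phi x).
    have <- : 'D_1 G 0 = \int[mu]_x (h x * 'D_(basis_vec i) phi x).
      by rewrite GE; apply: eq_Rintegral => x _; rewrite scale0r addr0.
    exact: dG.
  (* The increments are negative since the change of variables reverses the shift. *)
  have ctau : (forall n, - tau n != 0) /\ - tau n @[n --> \oo] --> (0 : R).
    split; first by move=> n; rewrite oppr_eq0 gt_eqF.
    rewrite -[X in _ --> X]oppr0; apply: cvgN.
    apply/cvgrPdist_le => c c0.
    have := near_infty_natSinv_lt (PosNum c0); apply: filterS => n nc.
    by rewrite sub0r normrN gtr0_norm// ltW.
  move/cvgr_dnbhsP : cG => /(_ _ ctau) cG.
  rewrite (_ : (fun n => \int[mu]_x (D n x * phi x)) = (fun n =>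
    - ((- tau n)^-1 *: ((G \o shift 0) (- tau n *: (1 : R)) - G 0)))); first exact: cvgN.
  apply/funext => n /=; symmetry.
  rewrite /G [_%:A]mulr1 addr0 scale0r.
  have iht := @L1_translate _ _ i (tau n) _ ph ih.
  have tpn := test_translate (- tau n *: basis_vec i) tp.
  have tp0 := test_translate 0 tp.
  have -> : \int[mu]_x (h x * phi (x + - tau n *: basis_vec i)) =
      \int[mu]_x (h (x + tau n *: basis_vec i) * phi x).
    rewrite -(@Rint_torus_translate _ _ i (tau n)
      (fun x => h x * phi (x + - tau n *: basis_vec i))).
    - by apply: eq_Rintegral => x _; rewrite scaleNr addrK.
    - exact/L1_measurable/L1_mul_test.
    - by move=> k x; rewrite ph (tpn.1 k).
  rewrite -RintB; [|exact: L1_mul_test..].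
  rewrite -mulNr -[- (- tau n)^-1]invrN opprK -RintZ.
    by apply: eq_Rintegral => x _; rewrite addr0 /D; ring.
  by apply: L1B; exact: L1_mul_test.
have [w bw Hw] := bounded_weak_limit bD cD.
exists w => //; have [mw pw wM] := bw.
apply: is_wpartialP => //; first exact: periodic_bounded_L1 bw.
by move=> phi tp; rewrite Hw// opprK.
Qed.

End lipschitz_weak_derivative.

(** * The score matching identity *)

Section score_matching.
Context {R : realType} {d : nat}.
Local Notation mu := (@torus_measure R d).
Local Notation L1 u := (mu.-integrable setT (EFin \o u)).
Implicit Types (u w f : 'rV[R]_d -> R) (g s : 'rV[R]_d -> 'rV[R]_d).

(** The version picked by [xget] enters the argument only through this property. *)
Lemma wpartialP i u w : is_wpartial i u w -> is_wpartial i u (wpartial i u).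
Proof. by move=> H; exact: (@xgetPex _ _ [set w | is_wpartial i u w]) (ex_intro _ w H). Qed.

Lemma RintSum (F : 'I_d -> 'rV[R]_d -> R) : (forall i, L1 (F i)) ->
  L1 (fun x => \sum_(i < d) F i x) /\
  \int[mu]_x (\sum_(i < d) F i x) = \sum_(i < d) \int[mu]_x F i x.
Proof.
move=> iF.
have H (r : seq 'I_d) : L1 (fun x => \sum_(i <- r) F i x) /\
    \int[mu]_x (\sum_(i <- r) F i x) = \sum_(i <- r) \int[mu]_x F i x.
  elim: r => [|i r [IH1 IH2]].
    rewrite (_ : (fun x => _) = cst 0); last by apply/funext => x; rewrite big_nil.
    by rewrite big_nil; split; [exact: (test_L1 (test_cst 0))|exact: Rint_cst].
  rewrite (_ : (fun x => _) = (fun x => F i x + \sum_(j <- r) F j x)); last first.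
    by apply/funext => x; rewrite big_cons.
  by rewrite big_cons; split; [exact: L1D|rewrite RintD// IH2].
exact: H.
Qed.

(** Each coordinate of [g] is integrated by parts against [f], whose weak derivative is [f s_j] by
    the chain rule. The product [f s_j] is kept as one factor: it is essentially bounded, so an L^1
    coordinate of [g] suffices and [g := s] is allowed. *)
Lemma expect_wdiv f s g :
  {ae mu, forall x, 0 < f x} -> Sobolev 2 +oo%E f -> score_of f s ->
  (forall j, exists w, is_wpartial j (coor j \o g) w) ->
  [/\ L1 (fun x => wdiv g x * f x),
      forall j, L1 (fun x => coor j (g x) * (f x * coor j (s x))) &
      expect f (wdiv g) =
        - \sum_(j < d) \int[mu]_x (coor j (g x) * (f x * coor j (s x)))].
Proof.
move=> f0 [Lf Sf] Hs Hg.
have [M fM] := Lp_oo_ae_bounded Lf.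
have [pf mf] : Zd_periodic f /\ measurable_fun setT f.
  by move: Lf => [pf]; rewrite inE => /andP[]; rewrite inE/=.
have Hj j : exists w, [/\ is_wpartial j (coor j \o g) w,
    w = wpartial j (coor j \o g),
    L1 (fun x => w x * f x), L1 (fun x => coor j (g x) * (f x * coor j (s x))) &
    \int[mu]_x (w x * f x) = - \int[mu]_x (coor j (g x) * (f x * coor j (s x)))].
  have [w0 /wpartialP Hw] := Hg j.
  have [df Hdf [Ldf _]] := Sf j.
  have [M' dfM] := Lp_oo_ae_bounded Ldf.
  have [pg ig pw iw] := is_wpartial_L1 Hw.
  have [_ if_ pdf idf] := is_wpartial_L1 Hdf.
  have [_ _ ps is_] := is_wpartial_L1 (Hs j).
  have dfE := ae_wpartial_chain f0 (Hs j) Hdf.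
  have mdf := L1_measurable idf; have ms := L1_measurable is_.
  have mg := L1_measurable ig; have mw := L1_measurable iw.
  pose K := `|M| + `|M'|.
  have fK : {ae mu, forall x, `|f x| <= K}.
    apply: filterS fM => x fx; apply: le_trans fx _.
    by rewrite (le_trans (ler_norm _))// lerDl.
  have dfK : {ae mu, forall x, `|df x| <= K}.
    apply: filterS dfM => x fx; apply: le_trans fx _.
    by rewrite (le_trans (ler_norm _))// lerDr.
  have K0 : 0 <= K by rewrite addr_ge0.
  exists (wpartial j (coor j \o g)); split => //.
  - have := L1_mul_bounded iw (measurable_truncate K mf) (fun x => truncate_norm_le (f x) K0).
    move=> H; apply: (L1_ae _ H); first exact: measurable_funM.
    by apply: filterS fK => x fx; rewrite truncate_id.
  - have := L1_mul_bounded ig (measurable_truncate K mdf) (fun x => truncate_norm_le (df x) K0).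
    move=> H; apply: (L1_ae _ H); first by apply: measurable_funM => //; exact: measurable_funM.
    by move: dfK dfE; apply: filterS2 => x fx E; rewrite truncate_id// E.
  - rewrite (is_wpartial_by_parts_ae Hw Hdf fK dfK); congr (- _).
    apply: ae_eq_Rintegral; [exact: measurable_funM| |].
      by apply: measurable_funM => //; exact: measurable_funM.
    by apply: filterS dfE => x ->.
have iwf j : L1 (fun x => wpartial j (coor j \o g) x * f x).
  by have [w [_ <-]] := Hj j.
have [isum Esum] := RintSum iwf.
have E x : wdiv g x * f x = \sum_(j < d) (wpartial j (coor j \o g) x * f x).
  by rewrite /wdiv mulr_suml.
split.
- by move: isum; congr (integrable _ _ _); apply/funext => x /=; rewrite E.
- by move=> j; have [w []] := Hj j.
- rewrite /expect; under eq_Rintegral do rewrite E.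
  rewrite Esum -sumrN; apply: eq_bigr => j _.
  by have [w [_ -> _ _]] := Hj j.
Qed.

(** Square integrability of [g] makes [|g|^2 f] integrable; for [s] the corresponding fact is
    [expect_wdiv] with [g := s], which also evaluates [ISM f s]. *)
Lemma ISM_decomposition f s g :
  {ae mu, forall x, 0 < f x} -> Sobolev 2 +oo%E f -> score_of f s ->
  (forall j, exists w, is_wpartial j (coor j \o s) w) ->
  (forall j, exists w, is_wpartial j (coor j \o g) w) ->
  (forall j, coor j \o g \in Lfun mu 2%:E) ->
  ISM f g = ISM f s + expect f (fun v => sqnorm (g v - s v)).
Proof.
move=> f0 Sf Hs Js Jg Lg.
have [iDs iss Es] := expect_wdiv f0 Sf Hs Js.
have [iDg igs Eg] := expect_wdiv f0 Sf Hs Jg.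
have igg j : L1 (fun x => coor j (g x) ^+ 2 * f x).
  have [Lf _] := Sf; have [M fM] := Lp_oo_ae_bounded Lf.
  have mf : measurable_fun setT f by move: Lf => [_]; rewrite inE => /andP[]; rewrite inE/=.
  have ig2 := Lfun2_integrable_sqr (Lg j).
  have M0 : 0 <= `|M| by [].
  have := L1_mul_bounded ig2 (measurable_truncate `|M| mf) (fun x => truncate_norm_le (f x) M0).
  move=> H; apply: (L1_ae _ H); first by apply: measurable_funM => //; exact: (L1_measurable ig2).
  by apply: filterS fM => x fx; rewrite truncate_id// (le_trans fx)// ler_norm.
have [iS2 ES2] := RintSum iss.
have [iG2 EG2] := RintSum igg.
have [iGS EGS] := RintSum igs.
pose SS := \sum_(j < d) \int[mu]_x (coor j (s x) * (f x * coor j (s x))).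
pose GG := \sum_(j < d) \int[mu]_x (coor j (g x) ^+ 2 * f x).
pose GS := \sum_(j < d) \int[mu]_x (coor j (g x) * (f x * coor j (s x))).
have -> : ISM f g = GG - 2 * GS.
  rewrite /ISM /expect.
  transitivity (\int[mu]_x ((\sum_(j < d) coor j (g x) ^+ 2 * f x) + 2 * (wdiv g x * f x))).
    by apply: eq_Rintegral => x _; rewrite mulrDl /sqnorm mulr_suml mulrA.
  rewrite RintD//; last exact: L1Z.
  by rewrite RintZ// EG2 -[X in 2 * X]/(expect f (wdiv g)) Eg mulrN.
have -> : ISM f s = - SS.
  rewrite /ISM /expect.
  transitivity (\int[mu]_x ((\sum_(j < d) coor j (s x) * (f x * coor j (s x))) +
      2 * (wdiv s x * f x))).
    apply: eq_Rintegral => x _; rewrite mulrDl /sqnorm mulr_suml mulrA; congr (_ + _).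
    by apply: eq_bigr => j _; ring.
  rewrite RintD//; last exact: L1Z.
  by rewrite RintZ// ES2 -[X in 2 * X]/(expect f (wdiv s)) Es /SS; ring.
have -> : expect f (fun v => sqnorm (g v - s v)) = GG - 2 * GS + SS.
  rewrite /expect.
  transitivity (\int[mu]_x ((\sum_(j < d) coor j (g x) ^+ 2 * f x) -
     2 * (\sum_(j < d) coor j (g x) * (f x * coor j (s x))) +
     \sum_(j < d) coor j (s x) * (f x * coor j (s x)))).
    apply: eq_Rintegral => x _; rewrite /sqnorm mulr_suml mulr_sumr -sumrB -big_split/=.
    by apply: eq_bigr => j _; rewrite /coor !mxE; ring.
  rewrite RintD//; last by apply: L1B => //; exact: L1Z.
  rewrite RintB//; last exact: L1Z.
  by rewrite RintZ// ES2 EG2 EGS.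
by ring.
Qed.

(** Squaring the square root in [delta2] requires a nonnegative expectation. As [f] may be negative
    on a null set, it is first replaced by [max 0 f]. *)
Lemma expect_ge0 f u : {ae mu, forall x, 0 < f x} -> measurable_fun setT f ->
  measurable_fun setT u -> (forall x, 0 <= u x) -> 0 <= expect f u.
Proof.
move=> f0 mf mu_ u0; rewrite /expect.
rewrite (ae_eq_Rintegral (w := fun x => u x * Num.max 0 (f x))).
- by apply: Rintegral_ge0 => x _; rewrite mulr_ge0// le_max lexx.
- exact: measurable_funM.
- by apply: measurable_funM => //; exact: measurable_maxr.
- by apply: filterS f0 => x fx; rewrite max_r// ltW.
Qed.

Lemma torus_lipschitz_coor g : torus_lipschitz g -> exists M, forall j x y,
  `|(coor j \o g) x - (coor j \o g) y| <= M * `|x - y|.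
Proof.
move=> [pg lg].
(* [lipschitz] asserts the bound for all sufficiently large constants; one of them is picked. *)
have [M HM] : exists M : R, M.-lipschitz g.
  by have [M [_ HM]] := lg; exists (M + 1); apply: HM; rewrite ltrDl.
exists M => j x y; apply: le_trans (HM (x, y) _) => //.
have -> : (coor j \o g) x - (coor j \o g) y = (g x - g y) ord0 j by rewrite /coor !mxE.
rewrite [leRHS]/Num.norm /= mx_normrE; apply/bigmax_geP; right.
by exists (ord0, j).
Qed.

End score_matching.

Theorem lemma2 (R : realType) (d : nat) (T : R)
    (f : R -> 'rV[R]_d -> R) (s : R -> 'rV[R]_d -> 'rV[R]_d)
    (stheta : 'rV[R]_d -> R -> 'rV[R]_d)
    (d23 : d = 2%N \/ d = 3%N)
    (T_gt0 : 0 < T)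
    (f_sobolev : forall r : R, 0 <= r <= T -> Sobolev 2 +oo%E (f r))
    (f_density : forall r : R, 0 <= r <= T -> positive_density (f r))
    (s_score : forall r : R, 0 <= r <= T -> score_of (f r) (s r))
    (s_jacobian : forall r : R, 0 <= r <= T -> bounded_wjacobian (s r))
    (stheta_lip : forall r : R, 0 <= r <= T -> torus_lipschitz (stheta^~ r))
    (t : R) (t_in : 0 <= t <= T) :
  (forall g : 'rV[R]_d -> 'rV[R]_d, vSobolev 1 2%:E g ->
     ISM (f t) g =
     ISM (f t) (s t) + expect (f t) (fun v => sqnorm (g v - s t v)))
  /\ delta2 (f t) (s t) (stheta^~ t) ^+ 2 =
     ISM (f t) (stheta^~ t) - ISM (f t) (s t).
Proof.
have [pf mf f0 _] := f_density t t_in.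
have Sf := f_sobolev t t_in; have Hs := s_score t t_in.
have Js j : exists w, is_wpartial j (coor j \o s t) w.
  by have [w Hw _] := s_jacobian t t_in j j; exists w.
split.
  move=> g Sg; apply: ISM_decomposition => // j; have [[_ Lg] Wg] := Sg j => //.
  by have [w Hw _] := Wg j; exists w.
(* The Lipschitz bound supplies both inputs of the decomposition: weak derivatives, and boundedness,
   hence membership in L^2. *)
have lip := stheta_lip t t_in; have [M HM] := torus_lipschitz_coor lip.
have pth j : Zd_periodic (coor j \o stheta^~ t).
  by move=> k x /=; have [p _] := lip; rewrite p.
have Wth j : exists w, is_wpartial j (coor j \o stheta^~ t) w.
  by have [w _ Hw] := lipschitz_is_wpartial j (pth j) (HM j); exists w.
have ith j : (torus_measure d).-integrable setT (EFin \o (coor j \o stheta^~ t)).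
  by have [w /is_wpartial_L1[]] := Wth j.
have Lth j : coor j \o stheta^~ t \in Lfun (torus_measure d) 2%:E.
  have [K _ HK] := lipschitz_bounded (pth j) (HM j).
  apply: (bounded_Lfun2 _ HK); exact: L1_measurable (ith j).
rewrite (ISM_decomposition f0 Sf Hs Js Wth Lth) addrAC subrr add0r /delta2 sqr_sqrtr//.
apply: expect_ge0 => //; last by move=> x; apply: sumr_ge0 => j _; exact: sqr_ge0.
apply: measurable_sum => j; apply: measurable_funX.
rewrite (_ : (fun x => _) = (fun x => (coor j \o stheta^~ t) x - (coor j \o s t) x)).
  have [_ _ _ is_] := is_wpartial_L1 (Hs j).
  by apply: measurable_funB; [exact: L1_measurable (ith j)|exact: L1_measurable is_].
by apply/funext => x; rewrite /coor !mxE.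
Qed.
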